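(* There is an absolute constant $C$ for which the following holds. Let $x_1,\dots,x_n$ be vectors in the unit ball of a Banach space and let $0<M\le\sqrt{n}$. If $0<\lambda<\log^{-3}(n/M^2)$ and $$\min_{\eta_i=\pm1}\Big\|\sum_{i\in\sigma}\eta_i x_i\Big\|\le M|\sigma|^{1/2}$$ for all $\sigma\subset\{1,\dots,n\}$ with $|\sigma|\le\lambda n$, then $$\mathbb{E}\Big\|\sum_{i=1}^n g_i x_i\Big\|\le C M (n/\lambda)^{1/2}.$$
   Context: $g_1,\dots,g_n$ are independent standard Gaussian random variables, $|\sigma|$ is the cardinality of $\sigma$, and $\log^{-3}(s)$ means $(\log s)^{-3}$.
   Formalization: Two hypotheses are added, since the claim fails without them: λ ≤ 1, and, when λn < 1 (so that the condition on σ concerns only the empty set), the sign condition is also required of singletons, that is ‖x_i‖ ≤ M for all i. *)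

(* Defs.v *)
From mathcomp Require Import all_boot all_order all_algebra.
From mathcomp Require Import all_classical all_reals all_analysis.
Import Order.TTheory GRing.Theory Num.Theory.
Import numFieldNormedType.Exports.

Set Implicit Arguments.
Unset Strict Implicit.
Unset Printing Implicit Defensive.

Local Open Scope classical_set_scope.
Local Open Scope ring_scope.

(* The product rule is required for every subfamily J, so this is mutual (not
   pairwise) independence. *)
Definition mutually_independent (R : realType) (d : measure_display)
    (T : measurableType d) (P : probability T R) (n : nat)
    (g : 'I_n -> {RV P >-> R}) : Prop :=
  forall (J : {set 'I_n}) (B : 'I_n -> set R),
    (forall i, measurable (B i)) ->
    P (\bigcap_(i in [set` J]) (g i @^-1` B i)) =
    (\prod_(i in J) P (g i @^-1` B i))%E.

Definition standard_gaussian (R : realType) (d : measure_display)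
    (T : measurableType d) (P : probability T R) (X : {RV P >-> R}) : Prop :=
  forall A : set R, measurable A -> distribution P X A = normal_prob 0 1 A.

Definition iid_standard_gaussian (R : realType) (d : measure_display)
    (T : measurableType d) (P : probability T R) (n : nat)
    (g : 'I_n -> {RV P >-> R}) : Prop :=
  mutually_independent g /\ (forall i, standard_gaussian (g i)).

(* \big[Num.min/_] needs a starting value; the one used here is the term for
   eta = (1, ..., 1), so this is the minimum over all sign patterns. *)
Definition min_signed_norm (R : realType) (E : normedModType R) (n : nat)
    (x : 'I_n -> E) (sigma : {set 'I_n}) : R :=
  \big[Num.min/ `|\sum_(i in sigma) x i| ]_(eta : {ffun 'I_n -> bool})
    `|\sum_(i in sigma) (-1) ^+ eta i *: x i|.

(* (log s)^-3, for s >= 1.  The inverse is that of extended reals, for which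
   0^-1 = +oo: at s = 1 the bound "lambda < log^-3 s" is no restriction,
   whereas 0^-1 = 0 in R would make it unsatisfiable. *)
Definition log_inv3 (R : realType) (s : R) : \bar R :=
  (((ln s) ^+ 3)%:E^-1)%E.

(* Main.v *)
Require Import Defs.
From mathcomp Require Import all_boot all_order all_algebra.
From mathcomp Require Import all_classical all_reals all_analysis.
From mathcomp Require Import measurable_realfun ring lra zify.
Import Order.TTheory GRing.Theory Num.Theory.
Import numFieldNormedType.Exports.
Local Open Scope ring_scope.
Set Implicit Arguments.
Unset Strict Implicit.
Unset Printing Implicit Defensive.

(** Let T be the set of all u in R^n with <a, u> <= |sum_i a_i x_i| for every
    a.  It lies in the cube [-1, 1]^n because the x_i are in the unit ball, and
    by Hahn-Banach ([exists_norming_functional]) the norm of sum_i g_i x_i is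
    the supremum over u in T of the Gaussian process <g, u>.  This supremum is
    bounded by chaining, so the point is to control the entropy of T in the
    normalised distance (n^-1 sum_i (u_i - v_i)^2)^(1/2).

    The sign hypothesis enters through shattering.  If T shatters a set sigma
    of coordinates with margin delta, choose for any sign pattern eta two
    elements of T realising eta and - eta: on sum_(i in sigma) eta_i x_i they
    differ by at least 2 delta |sigma|, while they have norm at most 1.  Hence
    delta |sigma| <= min_eta |sum eta_i x_i| <= M |sigma|^(1/2), that is
    |sigma| <= M^2 / delta^2 ([shattered_card_le]).  Since the hypothesis is
    restricted to |sigma| <= lambda n, this holds down to a margin delta of
    order M / (lambda n)^(1/2).

    A class that shatters few sets has small entropy.  In a finite family of N
    functions at mutual distance at least t, some coordinate has a variance of
    order t^2, so a level with a gap of order t splits the family into two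
    parts whose cardinals p and q satisfy sqrt p + sqrt q >= sqrt N
    ([level_split]).  A set shattered by both parts gives one more shattered set
    when the splitting point is added to it, so by induction the family shatters
    at least sqrt N sets ([card_separated_le_shattered]).  Counting the sets of
    cardinal at most M^2 / delta^2 gives log N <= C (M^2 / t^2) Lam with
    Lam = 1 + log(n / M^2) ([card_separated_functionals]).

    Chain along the scales t = 1, 1/2, 1/4, ..., down to M / (lambda n)^(1/2) up
    to a constant.  The Gaussian maximum at scale t costs n^(1/2) t (log N)^(1/2),
    which is C M (n Lam)^(1/2) for every t, and there are at most Lam scales:
    together C M n^(1/2) Lam^(3/2), which is at most C M (n / lambda)^(1/2)
    exactly because lambda < log^-3(n / M^2) ([mean_le_chaining],
    [log_factor_bound]).  What is left below the last scale costs at most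
    C n t, again of order M (n / lambda)^(1/2) ([norm_sum_le_net]).  If
    lambda n < 2 all the x_i have norm at most M and the triangle inequality
    suffices ([expectation_le_small_norms]).

    About the Gaussian variables one identity is used, namely
    E exp <a, g> = exp(|a|^2 / 2) ([integral_expR_iid_gaussian]): all random
    upper bounds are linear combinations of such exponentials. *)

(** * Cutting a function of large variance *)

(** If the tail beyond u + 2 delta (j + 1) always has at most a quarter of the
    mass of the tail beyond u + 2 delta j, the excess over u has a geometric
    tail, so its second moment is of order delta^2 times the mass of the tail.
    The factor four beats the factor two lost in (y + 2 delta)^2 <=
    2 y^2 + 8 delta^2, which makes the induction close with the constant 16. *)
Lemma tail_sq_sum (R : realType) (I : finType) (B : {set I}) (X : I -> R)
    (delta : R) (m : nat) (u : R) :
  0 < delta ->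
  (forall f, f \in B -> X f < u + 2 * delta * m%:R) ->
  (forall j : nat, (4 * #|[set f in B | (u + 2 * delta * j.+1%:R <= X f)%R]| <=
                 #|[set f in B | (u + 2 * delta * j%:R <= X f)%R]|)%N) ->
  \sum_(f in B | u <= X f) (X f - u) ^+ 2
    <= 16 * delta ^+ 2 * #|[set f in B | u <= X f]|%:R.
Proof.
move=> d0; elim: m u => [|m IH] u Xu quarter.
  rewrite big1 => [|f /andP[fB uX]].
    by do 2?apply: mulr_ge0 => //; rewrite ?sqr_ge0 ?ler0n.
  by have := Xu _ fB; rewrite mulr0 addr0 ltNge uX.
pose v := u + 2 * delta.
have uj j : u + 2 * delta * j.+1%:R = v + 2 * delta * j%:R.
  by rewrite /v -natr1; ring.
have v0 : v = v + 2 * delta * 0%:R by rewrite mulr0 addr0.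
have u0 : u = u + 2 * delta * 0%:R by rewrite mulr0 addr0.
have {}IH : \sum_(f in B | v <= X f) (X f - v) ^+ 2
    <= 16 * delta ^+ 2 * #|[set f in B | v <= X f]|%:R.
  apply: IH => [f fB|j]; first by rewrite -uj; exact: Xu.
  by rewrite -!uj; exact: quarter.
have cnt : 4 * #|[set f in B | v <= X f]|%:R <= #|[set f in B | u <= X f]|%:R :> R.
  by have := quarter 0%N; rewrite uj -v0 -u0 -natrM ler_nat.
have step : \sum_(f in B | u <= X f) (X f - u) ^+ 2 <=
    8 * delta ^+ 2 * #|[set f in B | u <= X f]|%:R +
    2 * \sum_(f in B | v <= X f) (X f - v) ^+ 2.
  have -> : 8 * delta ^+ 2 * #|[set f in B | u <= X f]|%:R =
      \sum_(f in B | u <= X f) 8 * delta ^+ 2.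
    rewrite -sumr_const big_distrr /=.
    by apply: eq_big => [f|f _]; rewrite ?inE ?mulr1.
  rewrite big_distrr /= !big_mkcondr -big_split /=.
  apply: ler_sum => f fB; rewrite /v.
  case: (lerP u (X f)) => h1; case: (lerP (u + 2 * delta) (X f)) => h2; try lra.
    by have := sqr_ge0 (X f - u - 4 * delta); nra.
  by nra.
have := @ler0n R #|[set f in B | v <= X f]|.
have := @ler0n R #|[set f in B | u <= X f]|.
move: step IH cnt; set a := #|_|%:R; set b := #|_|%:R; set s := \sum_(_ in B | _) _.
set r := \sum_(_ in B | _) _; move=> *.
by have := sqr_ge0 delta; nra.
Qed.

(** The integral form of sqrt lo + sqrt hi >= sqrt N: p and q stand for upper
    bounds of sqrt lo and sqrt hi.  As (N - a) b >= (a / 2) ^ 2, the double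
    product 2 p q makes up for the a points missing from lo. *)
Lemma leq_sqrD (N lo hi p q a b : nat) :
  (N <= lo + a)%N -> (2 * a <= N)%N -> (a <= 4 * b)%N -> (b <= hi)%N ->
  (lo <= p ^ 2)%N -> (hi <= q ^ 2)%N -> (N <= (p + q) ^ 2)%N.
Proof.
move=> h1 h2 h3 h4 h5 h6.
have apq : (a <= 2 * (p * q))%N.
  rewrite -leq_sqr expnMn expnMn.
  have alo : (a <= p ^ 2)%N.
    apply: leq_trans h5; rewrite -(leq_add2r a); apply: leq_trans h1.
    by rewrite addnn -mul2n.
  have aq : (a <= 4 * q ^ 2)%N.
    by apply: (leq_trans h3); rewrite leq_mul2l /= (leq_trans h4 h6).
  by apply: (leq_trans (leq_mul alo aq)); rewrite mulnCA.
apply: (leq_trans h1); rewrite sqrnD -addnA leq_add //.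
exact: leq_trans apq (leq_addl _ _).
Qed.

Lemma card_cover (I : finType) (B A1 A2 : {set I}) :
  (forall f, f \in B -> (f \in A1) || (f \in A2)) -> (#|B| <= #|A1| + #|A2|)%N.
Proof.
move=> h; apply: leq_trans (leq_card_setU A1 A2); apply: subset_leq_card.
by apply/fintype.subsetP => f fB; rewrite inE h.
Qed.

(** A function of large variance can be cut at a level of a fixed grid of mesh
    delta, with a gap of delta on both sides, so that the square roots of the
    cardinals of the two parts add up to at least the square root of the whole.
    Otherwise, by [leq_sqrD], the tails above and below the median would be
    divided by four at each step of length 2 delta, and [tail_sq_sum] would
    bound the variance by a multiple of delta^2. *)
Lemma level_split (R : realType) (I : finType) (B : {set I}) (X : I -> R)
    (delta : R) (L : nat) :
  0 < delta -> (forall f, f \in B -> -1 <= X f <= 1) -> 2 < L%:R * delta ->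
  128 * delta ^+ 2 * #|B|%:R ^+ 2 < \sum_(f in B) \sum_(g in B) (X f - X g) ^+ 2 ->
  exists l : 'I_L,
    let h := -1 + l%:R * delta in
    let lo := [set f in B | X f <= h - delta] in
    let hi := [set f in B | h + delta <= X f] in
    [/\ lo != finset.set0, hi != finset.set0 &
       forall p q : nat, (#|lo| <= p ^ 2)%N -> (#|hi| <= q ^ 2)%N ->
         (#|B| <= (p + q) ^ 2)%N].
Proof.
move=> d0 X1 Ld var; apply: contrapT => nosplit.
pose u (l : nat) : R := -1 + l%:R * delta.
have u_le k l : (k <= l)%N -> u k <= u l.
  by move=> kl; rewrite lerD2l ler_pM2r// ler_nat.
have B0 : (0 < #|B|)%N.
  rewrite lt0n; apply/eqP => /eqP; rewrite cards_eq0 => /eqP B0.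
  by move: var; rewrite B0 cards0 big_set0 expr0n /= mulr0 ltxx.
pose G l := #|[set f in B | u l <= X f]|.
have G0 : (#|B| <= 2 * G 0%N)%N.
  have -> : G 0%N = #|B|.
    apply: eq_card => f; rewrite !inE /u mul0r addr0.
    by case fB: (f \in B) => //=; case/andP: (X1 _ fB).
  by rewrite leq_pmull.
have Gb l : (#|B| <= 2 * G l)%N -> (l <= L)%N.
  apply: contraTT; rewrite -!ltnNge => Ll.
  suff -> : G l = 0%N by rewrite muln0.
  apply: eq_card0 => f; rewrite !inE; apply: negbTE.
  case fB: (f \in B) => //=; case/andP: (X1 _ fB) => _ fl1.
  rewrite -ltNge; apply: le_lt_trans fl1 _; apply: lt_le_trans (u_le _ _ (ltnW Ll)).
  by rewrite /u; lra.
(* u ls is a median of X: the last grid level with half of B above it. *)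
have [ls Gls lsmax] := ex_maxnP (ex_intro (fun l => #|B| <= 2 * G l)%N _ G0) Gb.
have Gls1 : (2 * G ls.+1 <= #|B|)%N.
  by rewrite leqNgt; apply/negP => /ltnW /lsmax; rewrite ltnn.
have up_quarter (j : nat) :
  (4 * #|[set f in B | (u ls.+1 + 2 * delta * j.+1%:R <= X f)%R]| <=
        #|[set f in B | (u ls.+1 + 2 * delta * j%:R <= X f)%R]|)%N.
  rewrite leqNgt; apply/negP => ab; apply: nosplit.
  set a := [set f in B | _] in ab; set b := [set f in B | _] in ab.
  have b0 : b != finset.set0 by apply/eqP => b0; move: ab; rewrite b0 cards0 muln0.
  have hp : u (ls.+2 + 2 * j)%N + delta = u ls.+1 + 2 * delta * j.+1%:R.
    by rewrite /u natrD natrM -!natr1; ring.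
  have hm : u (ls.+2 + 2 * j)%N - delta = u ls.+1 + 2 * delta * j%:R.
    by rewrite /u natrD natrM -!natr1; ring.
  have lL : (ls.+2 + 2 * j < L)%N.
    case/finset.set0Pn: b0 => f; rewrite !inE -hp => /andP[fB fl].
    rewrite ltnNge; apply/negP => /u_le; case/andP: (X1 _ fB) => _.
    by move: fl; rewrite {2}/u; lra.
  exists (Ordinal lL) => /=; rewrite -/(u _) hp hm -/b.
  set lo := [set f in B | _].
  have cov : (#|B| <= #|lo| + #|a|)%N.
    by apply: card_cover => f fB; rewrite !inE fB /=; exact: le_total.
  have a2 : (2 * #|a| <= #|B|)%N.
    apply: leq_trans Gls1; rewrite leq_mul2l /=; apply: subset_leq_card.
    apply/fintype.subsetP => f; rewrite !inE => /andP[-> /=]; apply: le_trans.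
    by rewrite lerDl !mulr_ge0 ?ler0n // ltW.
  split => //; last by move=> p q; exact: leq_sqrD cov a2 (ltnW ab) (leqnn _).
  apply/eqP => lo0; move: cov; rewrite lo0 cards0 add0n; apply/negP.
  by move: a2 B0; lia.
have dn_quarter (j : nat) :
  (4 * #|[set f in B | (delta - u ls + 2 * delta * j.+1%:R <= - X f)%R]| <=
        #|[set f in B | (delta - u ls + 2 * delta * j%:R <= - X f)%R]|)%N.
  rewrite leqNgt; apply/negP => ab; apply: nosplit.
  set a := [set f in B | _] in ab; set b := [set f in B | _] in ab.
  have b0 : b != finset.set0 by apply/eqP => b0; move: ab; rewrite b0 cards0 muln0.
  (* Below the grid there is no element of B, so the level is a grid point. *)
  have ls2 : (2 + 2 * j <= ls)%N.
    case/finset.set0Pn: b0 => f; rewrite !inE => /andP[fB fl].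
    rewrite -(ler_nat R) natrD natrM; case/andP: (X1 _ fB) => X1f _.
    have : (2 + 2 * j%:R) * delta <= ls%:R * delta.
      by move: fl; rewrite /u -natr1; nra.
    by rewrite ler_pM2r.
  have hE : (ls - (2 + 2 * j))%:R = ls%:R - 2 - 2 * j%:R :> R.
    by rewrite natrB// natrD natrM; ring.
  have hp : u (ls - (2 + 2 * j))%N + delta = u ls - delta - 2 * delta * j%:R.
    by rewrite /u hE; ring.
  have hm : u (ls - (2 + 2 * j))%N - delta = u ls - delta - 2 * delta * j.+1%:R.
    by rewrite /u hE -natr1; ring.
  have lL : (ls - (2 + 2 * j) < L)%N.
    by have := Gb _ Gls; move: ls2; lia.
  exists (Ordinal lL) => /=; rewrite -/(u _) hp hm.
  have -> : [set f in B | X f <= u ls - delta - 2 * delta * j.+1%:R] = b.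
    by apply/setP => f; rewrite !inE; congr (_ && _); apply/idP/idP; lra.
  set hi := [set f in B | _].
  have cov : (#|B| <= #|hi| + #|a|)%N.
    apply: card_cover => f fB; rewrite !inE fB /=.
    by case: (lerP (u ls - delta - 2 * delta * j%:R) (X f)) => //=; lra.
  have a2 : (2 * #|a| <= #|B|)%N.
    have : (#|a| <= #|B| - G ls)%N.
      rewrite -cardsDS; last by apply/fintype.subsetP => f; rewrite inE => /andP[].
      apply: subset_leq_card; apply/fintype.subsetP => f; rewrite !inE => /andP[fB].
      have : 0 <= 2 * delta * j%:R by rewrite !mulr_ge0 ?ler0n // ltW.
      by rewrite fB andbT /= -ltNge; lra.
    by move: Gls; lia.
  split => //.
    by apply/eqP => hi0; move: cov; rewrite hi0 cards0 add0n; apply/negP; move: a2 B0; lia.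
  by move=> p q hp' hq'; rewrite addnC; exact: leq_sqrD cov a2 (ltnW ab) (leqnn _) hq' hp'.
have upB : \sum_(f in B | u ls.+1 <= X f) (X f - u ls.+1) ^+ 2
    <= 8 * delta ^+ 2 * #|B|%:R.
  have /= := @tail_sq_sum R I B X delta L (u ls.+1) d0 _ up_quarter.
  move=> /(_ _)/le_trans; apply.
    move=> f fB; case/andP: (X1 _ fB) => _ /le_lt_trans; apply.
    have : u 0%N <= u ls.+1 by exact: u_le.
    by rewrite {1}/u; nra.
  rewrite -/(G _); have : 2 * (G ls.+1)%:R <= #|B|%:R :> R by rewrite -natrM ler_nat.
  by have := sqr_ge0 delta; nra.
have dnB : \sum_(f in B | delta - u ls <= - X f) (- X f - (delta - u ls)) ^+ 2
    <= 8 * delta ^+ 2 * #|B|%:R.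
  have /= := @tail_sq_sum R I B (fun f => - X f) delta L (delta - u ls) d0 _ dn_quarter.
  move=> /(_ _)/le_trans; apply.
    move=> f fB; case/andP: (X1 _ fB) => h1 _.
    have : u ls <= u L by apply: u_le; exact: Gb.
    by rewrite {2}/u; nra.
  set a := [set f in B | _].
  have : (#|a| <= #|B| - G ls)%N.
    rewrite -cardsDS; last by apply/fintype.subsetP => f; rewrite inE => /andP[].
    apply: subset_leq_card; apply/fintype.subsetP => f; rewrite !inE => /andP[fB].
    by rewrite fB andbT /= -ltNge; lra.
  have /[apply] : (#|a| <= #|B| - G ls)%N -> 2 * #|a|%:R <= #|B|%:R :> R.
    by rewrite -natrM ler_nat; move: Gls; lia.
  by have := sqr_ge0 delta; nra.
(* Both tails start at distance at most delta from the median, so the second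
   moment about c is at most twice theirs plus O(delta^2) per point. *)
pose c := u ls - delta.
have cB : \sum_(f in B) (X f - c) ^+ 2 <= 32 * delta ^+ 2 * #|B|%:R.
  have : \sum_(f in B) (X f - c) ^+ 2 <= 8 * delta ^+ 2 * #|B|%:R +
     2 * \sum_(f in B | u ls.+1 <= X f) (X f - u ls.+1) ^+ 2 +
     \sum_(f in B | delta - u ls <= - X f) (- X f - (delta - u ls)) ^+ 2.
    rewrite -sumr_const !big_distrr /= !big_mkcondr -!big_split /=.
    apply: ler_sum => f fB.
    have -> : u ls.+1 = c + 2 * delta by rewrite /c /u -natr1; ring.
    have -> : delta - u ls = - c by rewrite /c; ring.
    move: (X f) => y.
    case: (lerP (c + 2 * delta) y) => h1; case: (lerP (- c) (- y)) => h2; try lra.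
    - by have := sqr_ge0 (y - c - 4 * delta); nra.
    - by have := sqr_ge0 delta; nra.
    - by nra.
  by have := sqr_ge0 delta; nra.
have : \sum_(f in B) \sum_(g in B) (X f - X g) ^+ 2 <=
   4 * #|B|%:R * \sum_(f in B) (X f - c) ^+ 2.
  have -> : 4 * #|B|%:R * \sum_(f in B) (X f - c) ^+ 2 =
      \sum_(f in B) \sum_(g in B) (2 * (X f - c) ^+ 2 + 2 * (X g - c) ^+ 2).
    under [RHS]eq_bigr do rewrite big_split /= sumr_const -mulr_sumr -[_ *+ #|B|]mulr_natr.
    by rewrite big_split /= -mulr_suml -mulr_sumr sumr_const -[_ *+ #|B|]mulr_natr; ring.
  apply: ler_sum => f _; apply: ler_sum => g _.
  by have := sqr_ge0 (X f + X g - 2 * c); nra.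
have := ler0n R #|B|.
by move: var; nra.
Qed.

(** * Shattered sets *)

(** Shattering with margin delta, the witness of level at a point being part of
    the shattered set: V is a set of pairs (coordinate, level), and every subset
    U of V is cut out by some function of the family. *)
Definition shatters (R : realType) (I J K : finType) (F : I -> J -> R)
    (lev : K -> R) (delta : R) (B : {set I}) (V : {set J * K}) : bool :=
  [forall U : {set J * K}, [exists f in B, [forall p in V,
     if p \in U then lev p.2 + delta <= F f p.1 else F f p.1 <= lev p.2 - delta]]].

Lemma shattersP (R : realType) (I J K : finType) (F : I -> J -> R)
    (lev : K -> R) (delta : R) (B : {set I}) (V : {set J * K}) :
  reflect (forall U : {set J * K}, exists2 f, f \in B &
     forall p, p \in V -> if p \in U then lev p.2 + delta <= F f p.1
                          else F f p.1 <= lev p.2 - delta)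
    (shatters F lev delta B V).
Proof.
apply: (iffP forallP) => h U; have := h U.
  by case/exists_inP => f fB /forall_inP fV; exists f.
by case=> f fB fV; apply/exists_inP; exists f => //; apply/forall_inP.
Qed.

Lemma shattersS (R : realType) (I J K : finType) (F : I -> J -> R)
    (lev : K -> R) (delta : R) (B B' : {set I}) (V V' : {set J * K}) :
  B \subset B' -> V' \subset V ->
  shatters F lev delta B V -> shatters F lev delta B' V'.
Proof.
move=> /fintype.subsetP BB /fintype.subsetP VV /shattersP h; apply/shattersP => U.
by have [f fB fV] := h U; exists f => [|p /VV /fV//]; exact: BB.
Qed.

(** A set V shattered by both halves cannot contain the splitting point (i, k),
    since each half lies on one side of it, and V with that point added is
    shattered by the union.  So the sets shattered by both halves are counted
    twice on the right hand side as well. *)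
Lemma card_shattered_split (R : realType) (I J K : finType) (F : I -> J -> R)
    (lev : K -> R) (delta : R) (B lo hi : {set I}) (i : J) (k : K) :
  0 < delta -> lo \subset B -> hi \subset B ->
  (forall f, f \in lo -> F f i <= lev k - delta) ->
  (forall f, f \in hi -> lev k + delta <= F f i) ->
  (#|[set V | shatters F lev delta lo V]| + #|[set V | shatters F lev delta hi V]|
    <= #|[set V | shatters F lev delta B V]|)%N.
Proof.
move=> d0 loB hiB Flo Fhi; set Slo := finset _; set Shi := finset _; set S := finset _.
pose p := (i, k).
have pSlo V : V \in Slo -> p \notin V.
  rewrite inE => /shattersP /(_ [set p]) [f flo fV]; apply/negP => /fV.
  by rewrite set11 /=; have := Flo _ flo; lra.
have pShi V : V \in Shi -> p \notin V.
  rewrite inE => /shattersP /(_ finset.set0) [f fhi fV]; apply/negP => /fV.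
  by rewrite inE /=; have := Fhi _ fhi; lra.
(* |Slo| + |Shi| = |union| + |intersection|; the intersection is sent to the
   sets that contain p, which are disjoint from the union. *)
rewrite -cardsUI.
have -> : #|Slo :&: Shi| = #|[set p |: V | V in Slo :&: Shi]|.
  rewrite card_in_imset// => V W.
  rewrite !finset.in_setI => /andP[/pSlo pV _] /andP[/pSlo pW _].
  by move=> /(congr1 (fun Z => Z :\ p)); rewrite !setU1K.
set Sp := [set p |: V | V in Slo :&: Shi].
have dis : (Slo :|: Shi) :&: Sp = finset.set0.
  apply/setP => V; rewrite finset.in_setI finset.in_set0; apply/negP => /andP[VU].
  case/imsetP => W _ VE; have : p \in V by rewrite VE setU11.
  by apply/negP; move: VU; rewrite finset.in_setU => /orP[/pSlo|/pShi].
rewrite -cardsUI dis cards0 addn0.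
apply: subset_leq_card; apply/fintype.subsetP => V; rewrite !finset.in_setU -orbA.
case/or3P.
- by rewrite !inE; exact: shattersS.
- by rewrite !inE; exact: shattersS.
case/imsetP => W; rewrite !inE => /andP[/shattersP Wlo /shattersP Whi] ->.
apply/shattersP => U; case pU: (p \in U).
  have [f fhi fW] := Whi U; exists f; first exact: (fintype.subsetP hiB).
  by move=> q /setU1P[->|/fW//]; rewrite pU; exact: Fhi.
have [f flo fW] := Wlo U; exists f; first exact: (fintype.subsetP loB).
by move=> q /setU1P[->|/fW//]; rewrite pU; exact: Flo.
Qed.

(** Averaging the separation over the coordinates produces one coordinate whose
    variance over B is at least a fixed multiple of delta^2; [level_split] cuts B
    there, and [card_shattered_split] adds up the two halves. *)
Lemma card_separated_le_shattered (R : realType) (I J : finType) (F : I -> J -> R)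
    (t delta : R) (L : nat) (B : {set I}) :
  (0 < #|J|)%N -> 0 < delta -> 256 * delta ^+ 2 < t ^+ 2 -> 2 < L%:R * delta ->
  (forall f i, f \in B -> -1 <= F f i <= 1) ->
  (forall f g, f \in B -> g \in B -> f != g ->
     #|J|%:R * t ^+ 2 <= \sum_i (F f i - F g i) ^+ 2) ->
  (#|B| <= #|[set V : {set J * 'I_L} |
      shatters F (fun l : 'I_L => (-1 + l%:R * delta)%R) delta B V]| ^ 2)%N.
Proof.
move=> J0 d0 dt Ld; set lev := fun l : 'I_L => _.
have [m] := ubnP #|B|; elim: m B => // m IH B Bm F1 sep.
have [B1|B2] := leqP #|B| 1.
  have [->|[f fB]] := set_0Vmem B; first by rewrite cards0.
  apply: (leq_trans B1); rewrite sqrn_gt0; apply/card_gt0P; exists finset.set0.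
  by rewrite inE; apply/shattersP => U; exists f => // p; rewrite inE.
have [i vari] : exists i, 128 * delta ^+ 2 * #|B|%:R ^+ 2 <
    \sum_(f in B) \sum_(g in B) (F f i - F g i) ^+ 2.
  apply: contrapT => /forallNP small.
  have ub : \sum_i \sum_(f in B) \sum_(g in B) (F f i - F g i) ^+ 2 <=
      #|J|%:R * (128 * delta ^+ 2 * #|B|%:R ^+ 2).
    rewrite -sumr_const mulr_suml; apply: ler_sum => i _.
    by rewrite mul1r leNgt; apply/negP; exact: small.
  have : (#|B|%:R * (#|B|%:R - 1)) * (#|J|%:R * t ^+ 2) <=
      \sum_i \sum_(f in B) \sum_(g in B) (F f i - F g i) ^+ 2.
    rewrite exchange_big /=; under eq_bigr do rewrite exchange_big /=.
    rewrite -!mulrA -[X in X * _ <= _]sumr_const mulr_suml.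
    apply: ler_sum => f fB; rewrite mul1r.
    have -> : (#|B|%:R - 1) * (#|J|%:R * t ^+ 2) =
        \sum_(g in B :\ f) (#|J|%:R * t ^+ 2).
      by rewrite sumr_const -[RHS]mulr_natr mulrC (cardsD1 f B) fB add1n -natr1 addrK.
    rewrite [leRHS](big_setD1 f)//= -[leLHS]add0r lerD//.
      by apply: sumr_ge0 => i _; exact: sqr_ge0.
    by apply: ler_sum => g; rewrite finset.in_setD1 => /andP[gf gB]; rewrite sep// eq_sym.
  have : 2 <= #|B|%:R :> R by rewrite ler_nat.
  have : 0 < #|J|%:R :> R by rewrite ltr0n.
  move: ub; set s := \sum_i _; move: #|B|%:R #|J|%:R => b j ub j0 b2 lb.
  have := le_trans lb ub; apply/negP; rewrite -ltNge.
  have bb : 0 < b * (b - 1) by nra.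
  rewrite [ltRHS]mulrCA ltr_pM2l//.
  apply: (@le_lt_trans _ _ (256 * delta ^+ 2 * (b * (b - 1)))).
    by have := sqr_ge0 delta; nra.
  by rewrite [ltRHS]mulrC ltr_pM2r.
have [l /= []] := level_split d0 (fun f => F1 f i) Ld vari.
set lo := finset _; set hi := finset _ => lo0 hi0 comb.
have loB : lo \subset B by apply/fintype.subsetP => f; rewrite inE => /andP[].
have hiB : hi \subset B by apply/fintype.subsetP => f; rewrite inE => /andP[].
have dis f : f \in lo -> f \in hi -> False.
  by rewrite !inE => /andP[_ h1] /andP[_ h2]; move: d0 h1 h2; lra.
have lom : (#|lo| < #|B|)%N.
  apply: proper_card; apply/properP; split=> //.
  case/finset.set0Pn: hi0 => f fhi; exists f; first exact: (fintype.subsetP hiB).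
  by apply/negP => flo; exact: dis flo fhi.
have him : (#|hi| < #|B|)%N.
  apply: proper_card; apply/properP; split=> //.
  case/finset.set0Pn: lo0 => f flo; exists f; first exact: (fintype.subsetP loB).
  by apply/negP => fhi; exact: dis flo fhi.
have IHlo := IH lo (leq_trans lom Bm).
have IHhi := IH hi (leq_trans him Bm).
apply: leq_trans (comb _ _ (IHlo _ _) (IHhi _ _)) _.
- by move=> f j /(fintype.subsetP loB); exact: F1.
- by move=> f g /(fintype.subsetP loB) fB /(fintype.subsetP loB); exact: sep.
- by move=> f j /(fintype.subsetP hiB); exact: F1.
- by move=> f g /(fintype.subsetP hiB) fB /(fintype.subsetP hiB); exact: sep.
rewrite leq_sqr; apply: (@card_shattered_split _ _ _ _ _ _ _ _ _ _ i l) => //.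
- by move=> f; rewrite inE => /andP[].
- by move=> f; rewrite inE => /andP[].
Qed.

(** * Entropy of a family of functionals *)

(** A Chernoff bound on the number of small subsets of a set with Q elements:
    give the set V the weight q^|V|; the total weight is (1 + q)^Q <= exp(q Q),
    and every V of cardinal at most D weighs at least q^D. *)
Lemma card_small_sets (R : realType) (K : finType) (S : {set {set K}}) (D q : R) :
  0 < q -> q <= 1 -> (forall V, V \in S -> #|V|%:R <= D) ->
  #|S|%:R <= expR (D * - ln q + q * #|K|%:R).
Proof.
move=> q0 q1 SD.
have lnq : ln q <= 0 by exact: ln_le0.
have total : \sum_(V : {set K}) q ^+ #|V| <= expR (q * #|K|%:R).
  have -> : \sum_(V : {set K}) q ^+ #|V| = \prod_(k : K) (q + 1).
    rewrite bigA_distr; apply: eq_bigr => V _.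
    by rewrite -big_mkcond /= big_const iter_mulr_1.
  rewrite prodr_const expRM_natr; apply: lerXn2r; rewrite ?nnegrE ?expR_ge0 //.
    by rewrite addr_ge0 // ltW.
  by rewrite addrC expR_ge1Dx.
rewrite expRD; apply: le_trans (ler_wpM2l (expR_ge0 _) total).
rewrite mulr_sumr.
apply: (@le_trans _ _ (\sum_(V in S) 1)); first by rewrite sumr_const.
rewrite big_mkcond /=; apply: ler_sum => V _.
have [VS|_] := ifP; last by rewrite mulr_ge0 ?expR_ge0 ?exprn_ge0 // ltW.
have -> : q ^+ #|V| = expR (#|V|%:R * ln q) by rewrite expRM_natl lnK.
rewrite -expRD -[leLHS](expR0 R) ler_expR.
by have := SD _ VS; nra.
Qed.

(** The vectors of values (f(x_1), ..., f(x_n)) of the functionals f of norm at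
    most 1 on the span of the x_i. *)
Definition norm_functional (R : realType) (E : normedModType R) (n : nat)
    (x : 'I_n -> E) (u : 'I_n -> R) : Prop :=
  forall a : 'I_n -> R, \sum_i a i * u i <= `|\sum_i a i *: x i|.

Lemma norm_functional_le1 (R : realType) (E : normedModType R) (n : nat)
    (x : 'I_n -> E) (u : 'I_n -> R) :
  (forall i, `|x i| <= 1) -> norm_functional x u -> forall i, -1 <= u i <= 1.
Proof.
move=> x1 xu i.
have single (s : R) : s * u i <= `|s| * `|x i|.
  have := xu (fun j => if j == i then s else 0).
  rewrite (bigD1 i) //= eqxx big1 ?addr0 => [|j /negbTE ->]; last by rewrite mul0r.
  rewrite (bigD1 i) //= eqxx big1 ?addr0 => [|j /negbTE ->]; last by rewrite scale0r.
  by rewrite normrZ.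
have := single 1; have := single (-1); rewrite normrN normr1 !mul1r mulN1r.
by have := x1 i; lra.
Qed.

(** Two functionals that realise a sign pattern eta and its opposite on a
    shattered set differ by at least 2 delta at each of its points, so they
    separate the signed sum by 2 delta |sigma|.  A shattered set has at most one
    point above each coordinate, so it can be replaced by its projection. *)
Lemma shatters_min_signed_norm (R : realType) (E : normedModType R) (n : nat)
    (x : 'I_n -> E) (I K : finType) (F : I -> 'I_n -> R) (lev : K -> R)
    (delta : R) (B : {set I}) (V : {set 'I_n * K}) :
  0 < delta -> (forall f, f \in B -> norm_functional x (F f)) ->
  shatters F lev delta B V ->
  let sigma := fst @: V in
  #|sigma| = #|V| /\ delta * #|sigma|%:R <= min_signed_norm x sigma.
Proof.
move=> d0 xF /shattersP shV sigma.
have Vinj : {in V &, injective fst}.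
  move=> [i k] [j l] /= pV qV ij; move: qV; rewrite -{j}ij => qV.
  wlog kl : k l pV qV / lev k <= lev l.
    move=> h; case: (lerP (lev k) (lev l)) => [|/ltW] kl; first exact: h.
    by symmetry; exact: h.
  apply: contrapT => kl'.
  have [f fB fV] := shV [set (i, l)].
  have := fV _ pV; have := fV _ qV; rewrite set11 inE /=.
  case: eqP => [/kl'//|_] h1 h2.
  by move: h1 h2 kl d0; lra.
have sV : #|sigma| = #|V| by rewrite card_in_imset.
split=> //.
have lb (eta : 'I_n -> bool) :
    delta * #|sigma|%:R <= `|\sum_(i in sigma) (-1) ^+ eta i *: x i|.
  have [f fB fV] := shV [set p | ~~ eta p.1].
  have [g gB gV] := shV [set p | eta p.1].
  pose a i : R := if i \in sigma then (-1) ^+ eta i else 0.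
  have aE : \sum_(i in sigma) (-1) ^+ eta i *: x i = \sum_i a i *: x i.
    rewrite big_mkcond; apply: eq_bigr => i _; rewrite /a.
    by case: ifP => // _; rewrite scale0r.
  have fa := xF _ fB a.
  have := xF _ gB (fun i => - a i).
  have -> : \sum_i - a i *: x i = - \sum_i a i *: x i.
    by rewrite -sumrN; apply: eq_bigr => i _; rewrite scaleNr.
  have -> : \sum_i - a i * F g i = - \sum_i a i * F g i.
    by rewrite -sumrN; apply: eq_bigr => i _; rewrite mulNr.
  rewrite normrN -aE in fa *.
  have : 2 * delta * #|sigma|%:R <= \sum_i a i * F f i - \sum_i a i * F g i.
    rewrite -sumrB.
    have -> : \sum_i (a i * F f i - a i * F g i) =
       \sum_(i in sigma) (-1) ^+ eta i * (F f i - F g i).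
      rewrite [RHS]big_mkcond; apply: eq_bigr => i _; rewrite /a.
      by case: ifP => _; ring.
    rewrite -sumr_const mulr_sumr; apply: ler_sum => i /imsetP[p pV ->].
    have := fV _ pV; have := gV _ pV; rewrite !inE.
    by case: (eta p.1) => /=; rewrite ?expr0 ?expr1; lra.
  by lra.
rewrite /min_signed_norm; apply/bigmin_geP; split=> //.
have := lb (fun=> false).
by under eq_bigr do rewrite expr0 scale1r.
Qed.

(** Subsets of shattered sets are shattered, so a shattered set that is too large
    may be shrunk until its cardinal exceeds M^2 / delta^2 by at most one; then
    it is within the range D of the hypothesis on signs, which it violates. *)
Lemma shattered_card_le (R : realType) (E : normedModType R) (n : nat)
    (x : 'I_n -> E) (I K : finType) (F : I -> 'I_n -> R) (lev : K -> R)
    (delta M D : R) (B : {set I}) (V : {set 'I_n * K}) :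
  0 < delta -> 0 <= M -> M ^+ 2 / delta ^+ 2 + 1 <= D ->
  (forall sigma : {set 'I_n}, #|sigma|%:R <= D ->
     min_signed_norm x sigma <= M * Num.sqrt #|sigma|%:R) ->
  (forall f, f \in B -> norm_functional x (F f)) ->
  shatters F lev delta B V -> #|V|%:R <= M ^+ 2 / delta ^+ 2.
Proof.
move=> d0 M0 MD disc xF shV; rewrite leNgt; apply/negP => VM.
pose P (W : {set 'I_n * K}) := shatters F lev delta B W && (M ^+ 2 / delta ^+ 2 < #|W|%:R).
have PV : P V by rewrite /P shV.
case: (arg_minnP (fun W : {set 'I_n * K} => #|W|) PV) => W /andP[shW MW] Wmin.
have W0 : W != finset.set0.
  apply/eqP => W0; move: MW; rewrite W0 cards0 ltNge divr_ge0 ?sqr_ge0 //.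
have [p pW] := finset.set0Pn _ W0.
have WD : #|W|%:R <= D.
  apply: le_trans MD; rewrite leNgt; apply/negP => Wbig.
  have := Wmin (W :\ p); rewrite /P (shattersS (fintype.subxx _) (subD1set W p) shW) /=.
  move: Wbig; rewrite (cardsD1 p W) pW add1n -natr1 ltrD2r => -> /(_ isT).
  by rewrite ltnn.
have [sW] := shatters_min_signed_norm d0 xF shW.
have := disc (fst @: W); rewrite sW => /(_ WD) h1 /le_trans /(_ h1).
have : 0 < #|W|%:R :> R by rewrite ltr0n card_gt0.
rewrite ltr_pdivrMr ?exprn_gt0// in MW.
set w : R := #|W|%:R in MW *.
move=> w0 h2; have : (delta * w) ^+ 2 <= (M * Num.sqrt w) ^+ 2.
  by rewrite lerXn2r ?nnegrE ?mulr_ge0 ?sqrtr_ge0 // ltW.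
rewrite !exprMn sqr_sqrtr ?(ltW w0) // => h3.
have : delta ^+ 2 * w <= M ^+ 2.
  by rewrite -(ler_pM2r w0) -mulrA -expr2.
by rewrite mulrC leNgt MW.
Qed.

(** With the weight q = M^2 / n in [card_small_sets] the power q^-D gives the
    factor log(n / M^2), while q times the number of points, of order n / t, is
    at most of order M^2 / t^2. *)
Lemma card_separated_functionals (R : realType) (E : normedModType R) (n : nat)
    (x : 'I_n -> E) (I : finType) (F : I -> 'I_n -> R) (t M D : R) :
  (0 < n)%N -> 0 < M -> M <= Num.sqrt n%:R -> 0 < t -> t <= 1 ->
  400 * M ^+ 2 / t ^+ 2 + 1 <= D ->
  (forall sigma : {set 'I_n}, #|sigma|%:R <= D ->
     min_signed_norm x sigma <= M * Num.sqrt #|sigma|%:R) ->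
  (forall i, `|x i| <= 1) ->
  (forall f, norm_functional x (F f)) ->
  (forall f g, f != g -> n%:R * t ^+ 2 <= \sum_i (F f i - F g i) ^+ 2) ->
  #|I|%:R <= expR (2400 * (M ^+ 2 / t ^+ 2) * (1 + ln (n%:R / M ^+ 2))).
Proof.
move=> n0 M0 Mn t0 t1 MD disc x1 xF sep.
have F1 f i : -1 <= F f i <= 1 by exact: norm_functional_le1 x1 (xF f) i.
have [delta [d0 tE]] : exists delta, 0 < delta /\ t = 20 * delta.
  by exists (t / 20); split; [rewrite divr_gt0|field].
have d1 : delta <= 1 by move: t1; rewrite tE; lra.
have dt : 256 * delta ^+ 2 < t ^+ 2 by rewrite tE exprMn ltr_pM2r ?exprn_gt0 //; lra.
pose L := (Num.truncn (2 / delta)).+1.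
have Ld : 2 < L%:R * delta by rewrite -ltr_pdivrMr // truncnS_gt.
have Lub : L%:R <= 3 / delta.
  apply: (@le_trans _ _ (2 / delta + 1)).
    by rewrite /L -[X in X <= _]natr1 lerD2r truncn_le divr_ge0 // ltW.
  have -> : 3 / delta = 2 / delta + delta^-1 by ring.
  by rewrite lerD2l -invr1 lef_pV2 // posrE.
have ME : 400 * M ^+ 2 / t ^+ 2 = M ^+ 2 / delta ^+ 2.
  by rewrite tE; field; exact: lt0r_neq0.
rewrite ME in MD.
have nR : 0 < n%:R :> R by rewrite ltr0n.
have M2n : M ^+ 2 <= n%:R.
  by rewrite -[leRHS](@sqr_sqrtr R) ?ler0n // lerXn2r // nnegrE ?sqrtr_ge0 // ltW.
have card2 := @card_separated_le_shattered R I 'I_n F t delta L [set: I]%SET.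
rewrite card_ord cardsT in card2.
have {}card2 := card2 n0 d0 dt Ld (fun f i _ => F1 f i) (fun f g _ _ => sep f g).
set S := [set V | _] in card2.
pose q := M ^+ 2 / n%:R.
have q0 : 0 < q by rewrite divr_gt0 // exprn_gt0.
have q1 : q <= 1 by rewrite ler_pdivrMr // mul1r.
have S1 : #|S|%:R <= expR (M ^+ 2 / delta ^+ 2 * - ln q + q * #|{: 'I_n * 'I_L}|%:R).
  apply: card_small_sets => // V; rewrite inE.
  exact: (shattered_card_le d0 (ltW M0) MD disc (fun f _ => xF f)).
have lnqE : - ln q = ln (n%:R / M ^+ 2).
  by rewrite -[n%:R / _]invf_div lnV // posrE.
have ln0 : 0 <= ln (n%:R / M ^+ 2) by rewrite -lnqE oppr_ge0 ln_le0.
have qQ : q * #|{: 'I_n * 'I_L}|%:R <= 3 * (M ^+ 2 / delta ^+ 2).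
  rewrite card_prod !card_ord natrM /q.
  have -> : M ^+ 2 / n%:R * (n%:R * L%:R) = M ^+ 2 * L%:R by field; exact: lt0r_neq0.
  rewrite mulrCA ler_pM2l ?exprn_gt0 //; apply: (le_trans Lub).
  by rewrite ler_pM2l // lef_pV2 ?posrE ?exprn_gt0 // expr2 ler_piMl // ltW.
have : #|I|%:R <= #|S|%:R ^+ 2 :> R by rewrite -natrX ler_nat.
move/le_trans; apply.
apply: (@le_trans _ _ (expR (3 * (M ^+ 2 / delta ^+ 2) * (1 + ln (n%:R / M ^+ 2))) ^+ 2)).
  rewrite lerXn2r ?nnegrE ?expR_ge0 ?ler0n //; apply: (le_trans S1).
  rewrite ler_expR lnqE.
  have : 0 <= M ^+ 2 / delta ^+ 2 by rewrite divr_ge0 ?sqr_ge0.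
  by move: qQ ln0; nra.
rewrite -expRM_natl ler_expR.
have -> : 2400 * (M ^+ 2 / t ^+ 2) = 6 * (400 * M ^+ 2 / t ^+ 2) by ring.
by rewrite ME le_eqVlt; apply/orP; left; apply/eqP; ring.
Qed.

(** * Norming functionals *)

Definition sublinear (R : realType) (V : lmodType R) (p : V -> R) : Prop :=
  (forall u v, p (u + v) <= p u + p v) /\
  (forall (c : R) u, 0 <= c -> p (c *: u) = c * p u).

Lemma sublinear0 (R : realType) (V : lmodType R) (p : V -> R) :
  sublinear p -> p 0 = 0.
Proof. by case=> _ pZ; rewrite -(scale0r 0) pZ // mul0r. Qed.

(** The largest sublinear minorant of p that is linear along v with q(v) = p(v):
    it is the infimum of p(u + s v) - s p(v) over s >= 0. *)
Lemma sublinear_straighten (R : realType) (V : lmodType R) (p : V -> R) (v : V) :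
  sublinear p -> exists q : V -> R,
    [/\ sublinear q, forall u, q u <= p u, q v = p v & q (- v) = - p v].
Proof.
move=> psub; have [pD pZ] := psub.
have p0 := sublinear0 psub.
pose S u : set R := [set r | exists2 s : R, 0 <= s & r = p (u + s *: v) - s * p v]%classic.
pose q u := inf (S u).
have Slb u : lbound (S u) (- p (- u)).
  move=> r [s s0 ->]; have := pD (u + s *: v) (- u).
  by rewrite addrAC subrr add0r pZ //; lra.
have S0 u : S u (p u) by exists 0; rewrite // scale0r addr0 mul0r subr0.
have qle u (s : R) : 0 <= s -> q u <= p (u + s *: v) - s * p v.
  by move=> s0; apply: ge_inf; [exists (- p (- u)); exact: Slb | exists s].
have qge u r : lbound (S u) r -> r <= q u.
  by move=> lb; apply: lb_le_inf => //; exists (p u).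
have qp u : q u <= p u by apply: ge_inf => //; exists (- p (- u)); exact: Slb.
have qD u w : q (u + w) <= q u + q w.
  rewrite -lerBlDr; apply: (qge) => _ [s s0 ->]; rewrite lerBlDl -lerBlDr.
  apply: (qge) => _ [t t0 ->]; rewrite lerBlDr.
  apply: (le_trans (qle _ (s + t) (addr_ge0 s0 t0))).
  have := pD (u + s *: v) (w + t *: v).
  by rewrite addrACA -scalerDl; lra.
have q0 : q 0 = 0.
  apply/eqP; rewrite eq_le (le_trans (qp 0)) ?p0 //=; apply: (qge) => _ [s s0 ->].
  by rewrite add0r pZ // subrr.
have qZ (c : R) u : 0 <= c -> q (c *: u) = c * q u.
  rewrite le_eqVlt => /predU1P[<-|c0]; first by rewrite scale0r mul0r q0.
  have half (d : R) w : 0 < d -> q (d *: w) <= d * q w.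
    move=> d0; rewrite -ler_pdivrMl //; apply: (qge) => _ [s s0 ->].
    rewrite ler_pdivrMl //.
    have := qle (d *: w) (d * s) (mulr_ge0 (ltW d0) s0).
    by rewrite -scalerA -scalerDr pZ ?(ltW d0) // mulrBr mulrA.
  apply/eqP; rewrite eq_le half //=.
  have := half c^-1 (c *: u); rewrite invr_gt0 scalerA mulVf ?gt_eqF // scale1r.
  by move/(_ c0); rewrite ler_pdivlMl.
have qv : q v = p v.
  apply/eqP; rewrite eq_le qp /=; apply: (qge) => _ [s s0 ->].
  by rewrite -{2}(scale1r v) -scalerDl pZ ?addr_ge0 //; lra.
exists q; split=> //.
have := qle (- v) 1 ler01; rewrite scale1r addNr p0.
by have := qD v (- v); rewrite subrr q0 qv; lra.
Qed.

(** Linearity along a direction is inherited by every sublinear minorant, so the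
    directions can be straightened one after the other. *)
Lemma sublinear_straighten_seq (R : realType) (V : lmodType R) (p : V -> R)
    (v0 : V) (s : seq V) :
  sublinear p -> exists q : V -> R,
    [/\ sublinear q, forall u, q u <= p u, q v0 = p v0 &
        {in s, forall v, q (- v) = - q v}].
Proof.
move=> psub.
have [r [rsub rp rv rNv]] := sublinear_straighten v0 psub.
suff [q [qsub qr qN]] : exists q : V -> R,
    [/\ sublinear q, forall u, q u <= r u & {in s, forall v, q (- v) = - q v}].
  exists q; split=> //; first by move=> u; exact: le_trans (qr u) (rp u).
  apply/eqP; rewrite eq_le (le_trans (qr _) (rp _)) /=.
  have := qsub.1 v0 (- v0); rewrite subrr sublinear0 // => h.
  by have := qr (- v0); rewrite rNv; lra.
elim: s => [|v s [q [qsub qr qN]]]; first by exists r; split.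
have [q' [q'sub q'q q'v q'Nv]] := sublinear_straighten v qsub.
exists q'; split=> // [u|w]; first exact: le_trans (q'q u) (qr u).
rewrite inE => /predU1P[->|ws]; first by rewrite q'v q'Nv.
have := q'sub.1 w (- w); rewrite subrr sublinear0 // => h.
have := q'q (- w); have := q'q w; rewrite qN // => h1 h2.
by lra.
Qed.

(** Hahn-Banach for the span of the x_i: straighten the norm along
    sum_i a_i x_i, which keeps the value there, and along all the x_i. *)
Lemma exists_norming_functional (R : realType) (E : normedModType R) (n : nat)
    (x : 'I_n -> E) (a : 'I_n -> R) :
  exists2 u : 'I_n -> R, norm_functional x u &
    \sum_i a i * u i = `|\sum_i a i *: x i|.
Proof.
have nsub : sublinear (fun v : E => `|v|).
  split=> [u v|c u c0]; first exact: ler_normD.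
  by rewrite normrZ ger0_norm.
have [q [qsub qn qa qN]] :=
  sublinear_straighten_seq (\sum_i a i *: x i) [seq x i | i <- enum 'I_n] nsub.
have qNx i : q (- x i) = - q (x i) by apply: qN; apply: map_f; rewrite mem_enum.
have [qD qZ] := qsub.
have qZx (c : R) i : q (c *: x i) = c * q (x i).
  have [c0|c0] := lerP 0 c; first exact: qZ.
  have -> : c *: x i = (- c) *: - x i by rewrite scalerN scaleNr opprK.
  by rewrite qZ ?qNx; [ring | rewrite oppr_ge0 ltW].
have qsum (b : 'I_n -> R) : q (\sum_i b i *: x i) <= \sum_i b i * q (x i).
  elim/big_ind2: _ => [|y r z t h1 h2|i _]; first by rewrite sublinear0.
  - by apply: (le_trans (qD _ _)); exact: lerD.
  - by rewrite qZx.
have qsumE (b : 'I_n -> R) : q (\sum_i b i *: x i) = \sum_i b i * q (x i).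
  apply/eqP; rewrite eq_le qsum /=.
  have := qsum (fun i => - b i).
  have -> : \sum_i - b i *: x i = - \sum_i b i *: x i.
    by rewrite -sumrN; apply: eq_bigr => i _; rewrite scaleNr.
  have -> : \sum_i - b i * q (x i) = - \sum_i b i * q (x i).
    by rewrite -sumrN; apply: eq_bigr => i _; rewrite mulNr.
  have := qD (\sum_i b i *: x i) (- \sum_i b i *: x i).
  by rewrite subrr sublinear0 //; lra.
exists (fun i => q (x i)) => [b|]; first by rewrite -qsumE.
by rewrite -qsumE.
Qed.

(** * Gaussian exponential moments *)

Section gaussian_exponentials.
Local Open Scope classical_set_scope.
Import HBNNSimple.

(** If nu is the image under phi of the measure of density H with respect to mu,
    then integrals with respect to nu are integrals of H times the composite.
    It serves twice: with phi the identity, H the Gaussian density and nu the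
    law of a Gaussian variable, and in [integral_prod_independent] with H the
    product of the remaining factors. *)
Lemma ge0_integral_density d1 d2 (X : measurableType d1) (Y : measurableType d2)
    (R : realType) (phi : X -> Y) (mu : {measure set X -> \bar R})
    (nu : {measure set Y -> \bar R}) (H : X -> R) (f : Y -> R) :
  measurable_fun setT phi -> measurable_fun setT H -> (forall x, 0 <= H x) ->
  (forall B, measurable B -> nu B = (\int[mu]_(x in phi @^-1` B) (H x)%:E)%E) ->
  measurable_fun setT f -> (forall y, 0 <= f y) ->
  (\int[nu]_y (f y)%:E = \int[mu]_x (f (phi x) * H x)%:E)%E.
Proof.
move=> mphi mH H0 nuE mf f0.
have mef : measurable_fun setT (EFin \o f) by exact/measurable_EFinP.
have ef0 y : setT y -> (0 <= (EFin \o f) y)%E by rewrite lee_fin.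
pose f_ := nnsfun_approx measurableT mef.
have f_cvg y : (EFin \o f_^~ y) @ \oo --> (f y)%:E.
  exact: (cvg_nnsfun_approx measurableT mef ef0 (x := y)).
have f_nd y : {homo f_^~ y : m n / (m <= n)%N >-> m <= n}.
  by move=> m n mn; exact/lefP/nd_nnsfun_approx.
have mfphi n : measurable_fun setT (f_ n \o phi) by exact: measurableT_comp.
transitivity (limn (fun n => \int[nu]_y (f_ n y)%:E)%E).
  rewrite -monotone_convergence//.
  - by apply: eq_integral => y _; apply/esym/cvg_lim => //; exact: f_cvg.
  - by move=> n; exact/measurable_EFinP/measurable_funP.
  - by move=> n y _; rewrite lee_fin.
  - by move=> y _ m n mn; rewrite lee_fin; exact: f_nd.
transitivity (limn (fun n => \int[mu]_x (f_ n (phi x) * H x)%:E)%E); last first.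
  rewrite -monotone_convergence//.
  - apply: eq_integral => x _; apply/cvg_lim => //.
    under eq_fun do rewrite EFinM.
    by rewrite EFinM; apply: cvgeZr => //; exact: f_cvg.
  - by move=> n; apply/measurable_EFinP; apply: measurable_funM => //; exact: mfphi.
  - by move=> n x _; rewrite lee_fin mulr_ge0.
  - by move=> x _ m n mn; rewrite lee_fin ler_wpM2r//; exact: f_nd.
congr (limn _); apply/funext => n.
have mpre r : measurable (phi @^-1` (f_ n @^-1` [set r])).
  by rewrite -[X in measurable X]setTI; apply: mphi => //; exact: measurable_sfunP.
transitivity (\sum_(r \in range (f_ n)) r%:E * nu (f_ n @^-1` [set r]))%E.
  under eq_integral do rewrite fimfunE -fsumEFin//.
  rewrite ge0_integral_fsum//.
  - by apply: eq_fsbigr => r _; rewrite integralZl_indic_nnsfun// integral_indic// setIT.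
  - by move=> y; exact/measurable_EFinP/measurable_funM.
  - by move=> y x _; rewrite nnfun_muleindic_ge0.
under [RHS]eq_integral => x _.
  rewrite fimfunE EFinM -fsumEFin// ge0_mule_fsuml; last first.
    by move=> r; rewrite nnfun_muleindic_ge0.
  over.
rewrite ge0_integral_fsum//; last 2 first.
- move=> r; apply: emeasurable_funM; apply/measurable_EFinP => //.
  apply: measurable_funM => //.
  exact: (measurable_indic (mpre r)).
- move=> r x _; apply: mule_ge0; last by rewrite lee_fin.
  exact: (nnfun_muleindic_ge0 (f_ n) r (phi x)).
apply: eq_fsbigr => r _; rewrite nuE//.
have [r0|r0] := ltP r 0.
  rewrite preimage_nnfun0 // preimage_set0 integral_set0 mule0.
  by rewrite integral0_eq// => x _; rewrite indic0 mulr0 mul0e.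
rewrite -ge0_integralZl//; last 2 first.
- by apply/measurable_EFinP; exact: measurable_funTS.
- by move=> x _; rewrite lee_fin.
rewrite integral_mkcond; apply: eq_integral => x _.
rewrite patchE indicE.
have -> : (x \in phi @^-1` (f_ n @^-1` [set r])) = (phi x \in f_ n @^-1` [set r]).
  by apply/idP/idP; rewrite !inE.
by case: ifP => _; rewrite ?mulr1 ?mulr0 ?mul0e.
Qed.

(** Completing the square turns exp(a y) times the standard Gaussian density
    into exp(a^2 / 2) times the Gaussian density of mean a. *)
Lemma integral_expR_gaussian (R : realType) (d : measure_display)
    (T : measurableType d) (P : probability T R) (X : {RV P >-> R}) (a : R) :
  standard_gaussian X ->
  (\int[P]_w (expR (a * X w))%:E = (expR (a ^+ 2 / 2))%:E)%E.
Proof.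
move=> gX.
have mexp : measurable_fun setT (fun y : R => expR (a * y)).
  by apply: measurableT_comp => //; exact: measurable_funM.
have -> : (\int[P]_w (expR (a * X w))%:E = \int[distribution P X]_y (expR (a * y))%:E)%E.
  rewrite ge0_integral_pushforward //; first exact/measurable_EFinP.
(* The law of X lives on the Borel sets, Lebesgue measure on the sigma-algebra
   generated by the intervals; these agree, and id carries one to the other. *)
have mid : @measurable_fun _ _ (measurableTypeR R) R setT id.
  by move=> _ B mB; rewrite setTI.
have E := @ge0_integral_density _ _ (measurableTypeR R) R R id lebesgue_measure
   (distribution P X) (normal_pdf 0 1) _ mid (measurable_normal_pdf 0 1)
   (normal_pdf_ge0 0 1) gX mexp (fun y => expR_ge0 _).
apply: (eq_trans E) => {E}.
transitivity (\int[@lebesgue_measure R]_y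
    ((expR (a ^+ 2 / 2))%:E * (normal_pdf a 1 y)%:E))%E; last first.
  rewrite ge0_integralZl_EFin ?expR_ge0 ?integral_normal_pdf ?mule1 //.
  - by move=> y _; rewrite lee_fin normal_pdf_ge0.
  - by apply/measurable_EFinP; exact: measurable_normal_pdf.
apply: eq_integral => y _; rewrite -EFinM; congr EFin.
rewrite /normal_pdf oner_eq0 /normal_fun mulrCA [RHS]mulrCA.
by congr (_ * _); rewrite -!expRD; congr expR; field.
Qed.

(** Independence is given for indicators.  The factors are replaced by general
    functions one coordinate at a time: the product of the other factors is a
    density against which the law of the current variable is seen to be
    proportional to itself. *)
Lemma integral_prod_independent (R : realType) (d : measure_display)
    (T : measurableType d) (P : probability T R) (n : nat)
    (g : 'I_n -> {RV P >-> R}) (h : 'I_n -> R -> R) :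
  mutually_independent g -> (forall i, measurable_fun setT (h i)) ->
  (forall i y, 0 <= h i y) ->
  (forall i, (\int[P]_w (h i (g i w))%:E < +oo)%E) ->
  (\int[P]_w (\prod_i h i (g i w))%:E = \prod_i \int[P]_w (h i (g i w))%:E)%E.
Proof.
move=> ind mh h0 hfin.
have mpre i (B : set R) : measurable B -> measurable (g i @^-1` B).
  by move=> mB; rewrite -[X in measurable X]setTI; exact: measurable_funP.
have intB i (B : set R) : measurable B ->
    (\int[P]_w (\1_B (g i w))%:E = P (g i @^-1` B))%E.
  move=> mB; transitivity (\int[P]_w (\1_(g i @^-1` B) w)%:E)%E => //.
  by rewrite integral_indic ?setIT //; exact: mpre.
(* The first k factors are arbitrary, the other ones are indicators. *)
suff H k : (k <= n)%N -> forall h : 'I_n -> R -> R,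
    (forall i, measurable_fun setT (h i)) -> (forall i y, 0 <= h i y) ->
    (forall i, (\int[P]_w (h i (g i w))%:E < +oo)%E) ->
    (forall i : 'I_n, (k <= i)%N -> exists2 B : set R, measurable B & h i = \1_B) ->
  (\int[P]_w (\prod_i h i (g i w))%:E = \prod_i \int[P]_w (h i (g i w))%:E)%E.
  by apply: (H n (leqnn n)) => // i; rewrite leqNgt ltn_ord.
elim: k => [_|k IH kn] {mh h0 hfin}h mh h0 hfin hind.
  have [B mB hB] : exists2 B : 'I_n -> set R, forall i, measurable (B i) &
      forall i, h i = \1_(B i).
    exists (fun i => projT1 (cid2 (hind i (leq0n i)))) => i; by case: cid2.
  have := ind finset.setT B mB.
  have -> : [set` finset.setT] = [set: 'I_n].
    by apply/seteqP; split => i //= _; rewrite finset.in_setT.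
  rewrite (eq_bigl predT) => [|i]; last by rewrite finset.in_setT.
  set A := \bigcap_(_ in _) _ => PA.
  have mA : measurable A by apply: fin_bigcap_measurable => // i _; exact: mpre.
  transitivity (\int[P]_w (\1_A w)%:E)%E.
    apply: eq_integral => w _; congr EFin; rewrite indicE.
    case: (boolP (w \in A)) => [|].
      by rewrite inE => wA; rewrite big1 // => i _; rewrite hB indicE mem_set //; exact: wA.
    rewrite notin_setE => /existsNP[i /not_implyP[_ wi]].
    by rewrite (bigD1 i) //= hB indicE memNset // mul0r.
  rewrite integral_indic // setIT; apply: (eq_trans PA); apply: eq_bigr => i _.
  by rewrite hB intB.
pose k0 := Ordinal kn.
pose H w := \prod_(i | i != k0) h i (g i w).
pose c := (\prod_(i | i != k0) \int[P]_w (h i (g i w))%:E)%E.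
have mH : measurable_fun setT H.
  rewrite /H; under eq_fun do rewrite -big_filter.
  by apply: measurable_prod => i _; exact: measurableT_comp.
have H0 w : 0 <= H w by apply: prodr_ge0 => i _.
have int0 i : (0 <= \int[P]_w (h i (g i w))%:E)%E.
  by apply: integral_ge0 => w _; rewrite lee_fin.
have [c' c'0 cE] : exists2 c' : R, 0 <= c' & c = c'%:E.
  exists (\prod_(i | i != k0) fine (\int[P]_w (h i (g i w))%:E)%E).
    by apply: prodr_ge0 => i _; exact: fine_ge0.
  rewrite -prodEFin; apply: eq_bigr => i _; rewrite fineK //.
  by rewrite ge0_fin_numE.
have HB B : measurable B ->
    (mscale (NngNum c'0) (distribution P (g k0)) B =
     \int[P]_(w in g k0 @^-1` B) (H w)%:E)%E.
  move=> mB; pose hb i := if i == k0 then \1_B : R -> R else h i.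
  have hbk : hb k0 = \1_B by rewrite /hb eqxx.
  have hbN i : i != k0 -> hb i = h i by rewrite /hb => /negbTE ->.
  have -> : (\int[P]_(w in g k0 @^-1` B) (H w)%:E =
      \int[P]_w (\prod_i hb i (g i w))%:E)%E.
    rewrite integral_mkcond; apply: eq_integral => w _.
    rewrite (bigD1 k0) //= patchE hbk indicE.
    have -> : (w \in g k0 @^-1` B) = (g k0 w \in B) by apply/idP/idP; rewrite !inE.
    case: ifP => _; rewrite ?mul0r // mul1r; congr EFin.
    by apply: eq_bigr => i ik; rewrite hbN.
  rewrite (IH (ltnW kn) hb).
  - rewrite (bigD1 k0) //= hbk intB // muleC /mscale /= -cE; congr (_ * _)%E.
    by apply: eq_bigr => i ik; rewrite hbN.
  - by move=> i; rewrite /hb; case: ifP => // _; exact: measurable_indic.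
  - by move=> i y; rewrite /hb; case: ifP.
  - move=> i; rewrite /hb; case: ifP => // _; rewrite intB //.
    by apply: le_lt_trans (ltry 1); apply: probability_le1; exact: mpre.
  - move=> i; rewrite leq_eqVlt => /orP[/eqP ki|ki].
      by exists B => //; rewrite -hbk; congr hb; exact: val_inj.
    rewrite hbN; first exact: hind.
    by apply/eqP => ik; move: ki; rewrite ik ltnn.
have mgk : measurable_fun setT (g k0) by exact: measurable_funP.
have E := ge0_integral_density mgk mH H0 HB (mh k0) (h0 k0).
transitivity (\int[P]_w (h k0 (g k0 w) * H w)%:E)%E.
  by apply: eq_integral => w _; rewrite (bigD1 k0).
rewrite -E ge0_integral_mscale //; last 2 first.
- by apply/measurable_EFinP; exact: mh.
- by move=> y _; rewrite lee_fin.
rewrite (bigD1 k0) //= -/c cE muleC; congr (_ * _)%E.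
rewrite ge0_integral_pushforward //; first exact/measurable_EFinP.
by move=> y _; rewrite lee_fin.
Qed.

Lemma integral_expR_iid_gaussian (R : realType) (d : measure_display)
    (T : measurableType d) (P : probability T R) (n : nat)
    (g : 'I_n -> {RV P >-> R}) (a : 'I_n -> R) :
  iid_standard_gaussian g ->
  (\int[P]_w (expR (\sum_i a i * g i w))%:E = (expR ((\sum_i a i ^+ 2) / 2))%:E)%E.
Proof.
move=> [ind gg].
under eq_integral do rewrite expR_sum.
rewrite (@integral_prod_independent _ _ _ _ _ g (fun i y => expR (a i * y))) //.
- under eq_bigr do rewrite integral_expR_gaussian //.
  by rewrite prodEFin -expR_sum mulr_suml.
- by move=> i; apply: measurableT_comp => //; exact: measurable_funM.
- by move=> i; rewrite integral_expR_gaussian // ltry.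
Qed.

End gaussian_exponentials.

(** * Expectation bounds *)

(** The integral of a nonnegative function is a supremum over the simple
    functions below it, so it is monotone on non-measurable functions as well;
    this spares the measurability of the norm of a random vector of E. *)
Lemma ge0_integral_mono (d : measure_display) (T : measurableType d)
    (R : realType) (mu : {measure set T -> \bar R}) (f h : T -> \bar R) :
  (forall x, 0 <= f x)%E -> (forall x, f x <= h x)%E ->
  (\int[mu]_x f x <= \int[mu]_x h x)%E.
Proof.
move=> f0 fh; rewrite !ge0_integralTE //; last by move=> x; exact: le_trans (fh x).
by apply: le_ereal_sup => _ [k kf <-]; exists k => // x; exact: le_trans (fh x).
Qed.

(** An upper bound on the expectation, packed with integrability so that it is
    stable under sums, nonnegative multiples and constants of either sign. *)
Definition mean_le (d : measure_display) (T : measurableType d) (R : realType)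
    (P : probability T R) (W : T -> R) (b : R) : Prop :=
  P.-integrable setT (EFin \o W) /\ (\int[P]_w (W w)%:E <= b%:E)%E.

Section mean_le.
Context (d : measure_display) (T : measurableType d) (R : realType).
Context (P : probability T R).

Lemma mean_leW (W : T -> R) (b c : R) : b <= c -> mean_le P W b -> mean_le P W c.
Proof. by move=> bc [iW /le_trans Wb]; split => //; rewrite Wb. Qed.

Lemma mean_le_cst (c : R) : mean_le P (fun=> c) c.
Proof.
split; first exact: finite_measure_integrable_cst.
by rewrite integral_cst //= probability_setT mule1.
Qed.

Lemma mean_leD (V W : T -> R) (b c : R) :
  mean_le P V b -> mean_le P W c -> mean_le P (fun w => V w + W w) (b + c).
Proof.
move=> [iV Vb] [iW Wc]; split; first exact: (integrableD measurableT iV iW).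
by rewrite integralD_EFin // EFinD leeD.
Qed.

Lemma mean_leZ (W : T -> R) (a b : R) :
  0 <= a -> mean_le P W b -> mean_le P (fun w => a * W w) (a * b).
Proof.
move=> a0 [iW Wb]; split; first exact: (integrableZl measurableT a iW).
under eq_integral do rewrite EFinM.
by rewrite integralZl // EFinM lee_wpmul2l ?lee_fin.
Qed.

Lemma mean_le_sum (I : Type) (r : seq I) (W : I -> T -> R) (b : I -> R) :
  (forall i, mean_le P (W i) (b i)) ->
  mean_le P (fun w => \sum_(i <- r) W i w) (\sum_(i <- r) b i).
Proof.
move=> Wb; elim: r => [|i r IH].
  by rewrite big_nil; under eq_fun do rewrite big_nil; exact: mean_le_cst.
rewrite big_cons; under eq_fun do rewrite big_cons.
exact: mean_leD.
Qed.

Lemma expectation_le_mean (f W : T -> R) (b : R) :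
  (forall w, 0 <= f w <= W w) -> mean_le P W b -> ('E_P[f] <= b%:E)%E.
Proof.
move=> fW [_]; apply: le_trans; rewrite unlock.
by apply: ge0_integral_mono => w; rewrite lee_fin; case/andP: (fW w).
Qed.

Lemma mean_le_expR (n : nat) (g : 'I_n -> {RV P >-> R}) (a : 'I_n -> R) :
  iid_standard_gaussian g ->
  mean_le P (fun w => expR (\sum_i a i * g i w)) (expR ((\sum_i a i ^+ 2) / 2)).
Proof.
move=> gg; have E := integral_expR_iid_gaussian a gg.
split; last by rewrite E.
apply/integrableP; split.
  apply/measurable_EFinP/measurableT_comp => //.
  by apply: measurable_sum => i; exact: measurable_funM.
under eq_integral do rewrite /= ger0_norm ?expR_ge0 //.
by rewrite E ltry.
Qed.

Lemma mean_le_expR_coord (n : nat) (g : 'I_n -> {RV P >-> R}) (s : R) (i : 'I_n) :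
  iid_standard_gaussian g ->
  mean_le P (fun w => expR (s * g i w)) (expR (s ^+ 2 / 2)).
Proof.
move=> gg; have := mean_le_expR (fun j => if j == i then s else 0) gg.
rewrite (bigD1 i) //= eqxx big1 ?addr0 => [|j /negbTE ->]; last by rewrite expr0n.
congr (mean_le P _ _); apply/funext => w; congr expR.
by rewrite (bigD1 i) //= eqxx big1 ?addr0 // => j /negbTE ->; rewrite mul0r.
Qed.

(** The expectation of the maximum of N <= exp B Gaussian variables of variance
    at most sigma2.  With A = B + s^2 sigma2 / 2, the inequality y <= exp y - 1
    applied to y = s X_j - A bounds every X_j by the single variable
    (A - 1 + sum_j exp(s X_j - A)) / s, in which the sum has mean at most 1. *)
Lemma mean_le_gaussian_max (n N : nat) (g : 'I_n -> {RV P >-> R})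
    (v : 'I_N -> 'I_n -> R) (s sigma2 B : R) :
  iid_standard_gaussian g -> 0 < s ->
  (forall j, \sum_i v j i ^+ 2 <= sigma2) -> N%:R <= expR B ->
  exists2 W : T -> R, mean_le P W (B / s + s * sigma2 / 2) &
    forall j w, \sum_i v j i * g i w <= W w.
Proof.
move=> gg s0 vs NB; pose A := B + s ^+ 2 * sigma2 / 2.
pose X j w := \sum_i (s * v j i) * g i w.
have XE j w : X j w = s * \sum_i v j i * g i w.
  by rewrite /X mulr_sumr; apply: eq_bigr => i _; rewrite mulrA.
exists (fun w => s^-1 * (A - 1 + \sum_j expR (- A) * expR (X j w))); last first.
  move=> j w; rewrite ler_pdivlMl // -XE.
  have := expR_ge1Dx (X j w - A).
  suff : expR (X j w - A) <= \sum_j expR (- A) * expR (X j w) by lra.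
  rewrite addrC expRD (bigD1 j) //= lerDl; apply: sumr_ge0 => k _.
  by apply: mulr_ge0; exact: expR_ge0.
pose b := s^-1 * (A - 1 + \sum_(j < N) expR (- A) * expR (s ^+ 2 * sigma2 / 2)).
apply: (@mean_leW _ b).
  rewrite /b sumr_const card_ord -expRD.
  have -> : - A + s ^+ 2 * sigma2 / 2 = - B by rewrite /A; ring.
  have : expR (- B) *+ N <= 1.
    by rewrite -mulr_natl expRN ler_pdivrMr ?expR_gt0 // mul1r.
  have -> : B / s + s * sigma2 / 2 = s^-1 * A.
    by rewrite /A; field; exact: lt0r_neq0.
  by move=> h; rewrite ler_pM2l ?invr_gt0 //; lra.
apply: mean_leZ; first by rewrite invr_ge0 ltW.
apply: mean_leD; first exact: mean_le_cst.
apply: mean_le_sum => j; apply: mean_leZ; first exact: expR_ge0.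
apply: mean_leW (mean_le_expR (fun i => s * v j i) gg).
rewrite ler_expR ler_pM2r ?invr_gt0 //.
under eq_bigr do rewrite exprMn.
by rewrite -mulr_sumr ler_pM2l ?exprn_gt0.
Qed.

Lemma sqr_le_expR (y : R) : y ^+ 2 <= 4 * (expR y + expR (- y)).
Proof.
have h (z : R) : 0 <= z -> z ^+ 2 <= 4 * expR z.
  move=> z0; have -> : expR z = expR (z / 2) ^+ 2.
    by rewrite -expRM_natl; congr expR; field.
  have := expR_ge1Dx (z / 2) => h.
  have : (z / 2) ^+ 2 <= expR (z / 2) ^+ 2.
    by rewrite lerXn2r ?nnegrE ?expR_ge0 //; lra.
  by rewrite exprMn exprVn; lra.
have := expR_gt0 y; have := expR_gt0 (- y).
have [y0|/ltW y0] := lerP 0 y; first by have := h _ y0; lra.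
by have := h (- y); rewrite sqrrN oppr_ge0 => /(_ y0); lra.
Qed.

Lemma norm_le_expR (y : R) : `|y| <= expR y + expR (- y).
Proof.
have := expR_ge1Dx y; have := expR_ge1Dx (- y).
have := expR_gt0 y; have := expR_gt0 (- y).
by case: (lerP 0 y) => y0; [rewrite ger0_norm|rewrite ltr0_norm]; lra.
Qed.

Lemma mean_le_cosh (n : nat) (g : 'I_n -> {RV P >-> R}) (i : 'I_n) :
  iid_standard_gaussian g ->
  mean_le P (fun w => expR (g i w) + expR (- g i w)) (2 * expR (1 / 2)).
Proof.
move=> gg.
have -> : (fun w => expR (g i w) + expR (- g i w)) =
    (fun w => expR (1 * g i w) + expR (-1 * g i w)).
  by apply/funext => w; rewrite mul1r mulN1r.
have -> : 2 * expR (1 / 2) = expR (1 ^+ 2 / 2) + expR ((-1) ^+ 2 / 2) :> R.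
  by rewrite sqrrN expr1n; ring.
by apply: mean_leD; exact: mean_le_expR_coord.
Qed.

End mean_le.

(** * Nets and chaining *)

(** A separated family of largest cardinal is a net, since any point separated
    from all its members could be added to it. *)
Lemma exists_maximal_separated (V : Type) (S : V -> Prop) (sep : V -> V -> Prop)
    (b : nat) (v0 : V) :
  (forall u v, sep u v -> sep v u) ->
  (forall N (F : 'I_N -> V), (forall j, S (F j)) ->
     (forall i j, i != j -> sep (F i) (F j)) -> (N <= b)%N) ->
  exists N, exists F : 'I_N -> V,
    [/\ forall j, S (F j), forall i j, i != j -> sep (F i) (F j) &
        forall u, S u -> exists j, ~ sep u (F j)].
Proof.
move=> sepC sepb.
pose Q N := `[< exists F : 'I_N -> V,
  (forall j, S (F j)) /\ (forall i j, i != j -> sep (F i) (F j)) >].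
have Q0 : Q 0%N by apply/asboolP; exists (fun=> v0); split=> -[].
have Qb N : Q N -> (N <= b)%N by case/asboolP => F [FS Fsep]; exact: sepb FS Fsep.
case: (ex_maxnP (ex_intro Q 0%N Q0) Qb) => N /asboolP[F [FS Fsep]] Nmax.
exists N, F; split=> // u Su; apply: contrapT => /forallNP far.
suff /Nmax : Q N.+1 by rewrite ltnn.
have {}far j : sep u (F j) by apply: contrapT; exact: far.
pose F' j := if unlift ord_max j is Some j' then F j' else u.
apply/asboolP; exists F'; split=> [j|i j]; rewrite /F'.
  by case: unliftP.
case: (unliftP ord_max i) => [i'|] ->; case: (unliftP ord_max j) => [j'|] -> //.
- by rewrite (inj_eq lift_inj); exact: Fsep.
- by move=> _; exact/sepC.
- by rewrite eqxx.
Qed.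

Lemma exists_net_functionals (R : realType) (E : normedModType R) (n : nat)
    (x : 'I_n -> E) (t M D : R) :
  (0 < n)%N -> 0 < M -> M <= Num.sqrt n%:R -> 0 < t -> t <= 1 ->
  400 * M ^+ 2 / t ^+ 2 + 1 <= D ->
  (forall sigma : {set 'I_n}, #|sigma|%:R <= D ->
     min_signed_norm x sigma <= M * Num.sqrt #|sigma|%:R) ->
  (forall i, `|x i| <= 1) ->
  exists N, exists F : 'I_N -> 'I_n -> R,
    [/\ N%:R <= expR (2400 * (M ^+ 2 / t ^+ 2) * (1 + ln (n%:R / M ^+ 2))),
        forall j, norm_functional x (F j) &
        forall u, norm_functional x u ->
          exists j, \sum_i (u i - F j i) ^+ 2 <= n%:R * t ^+ 2].
Proof.
move=> n0 M0 Mn t0 t1 MD disc x1; set bnd := expR _.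
pose sep (u v : 'I_n -> R) := n%:R * t ^+ 2 <= \sum_i (u i - v i) ^+ 2.
have sepC u v : sep u v -> sep v u.
  by rewrite /sep => /le_trans; apply; apply: ler_sum => i _; rewrite -sqrrN opprB.
have sepN N (F : 'I_N -> 'I_n -> R) : (forall j, norm_functional x (F j)) ->
    (forall i j, i != j -> sep (F i) (F j)) -> N%:R <= bnd.
  move=> Fx Fsep; have := card_separated_functionals n0 M0 Mn t0 t1 MD disc x1 Fx.
  by rewrite card_ord; apply => f h /Fsep.
have sepb N (F : 'I_N -> 'I_n -> R) : (forall j, norm_functional x (F j)) ->
    (forall i j, i != j -> sep (F i) (F j)) -> (N <= Num.truncn bnd)%N.
  by move=> Fx Fsep; rewrite truncn_ge_nat ?expR_ge0 //; exact: sepN Fx Fsep.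
have [N [F [Fx Fsep Fnet]]] := exists_maximal_separated (fun=> 0) sepC sepb.
exists N, F; split=> //; first exact: sepN Fx Fsep.
by move=> u /Fnet[j /negP]; rewrite -ltNge => /ltW h; exists j.
Qed.

(** Chaining down to the scale 2^-k: the maximum of <g, u> over the k-th net is
    at most its maximum over the previous net plus the maximum over the
    increments, which are Gaussian of variance of order n 4^-k and as many as the
    points of the new net.  Each step costs the same multiple of
    M (n Lam)^(1/2). *)
Lemma mean_le_chaining (R : realType) (E : normedModType R) (n : nat)
    (x : 'I_n -> E) (M D : R) (d : measure_display) (T : measurableType d)
    (P : probability T R) (g : 'I_n -> {RV P >-> R}) (k : nat) :
  iid_standard_gaussian g ->
  (0 < n)%N -> 0 < M -> M <= Num.sqrt n%:R ->
  ((0 < k)%N -> 400 * M ^+ 2 * 4 ^+ k + 1 <= D) ->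
  (forall sigma : {set 'I_n}, #|sigma|%:R <= D ->
     min_signed_norm x sigma <= M * Num.sqrt #|sigma|%:R) ->
  (forall i, `|x i| <= 1) ->
  exists W : T -> R, exists N, exists F : 'I_N -> 'I_n -> R,
    [/\ mean_le P W (k%:R * (2402 * M * Num.sqrt (n%:R * (1 + ln (n%:R / M ^+ 2))))),
        forall u, norm_functional x u ->
          exists j, \sum_i (u i - F j i) ^+ 2 <= n%:R / 4 ^+ k,
        forall j, norm_functional x (F j) &
        forall j w, \sum_i F j i * g i w <= W w].
Proof.
move=> gg n0 M0 Mn kD disc x1.
have nR : 0 < n%:R :> R by rewrite ltr0n.
have L1 : 1 <= 1 + ln (n%:R / M ^+ 2).
  rewrite lerDl ln_ge0 // ler_pdivlMr ?exprn_gt0 // mul1r.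
  by rewrite -[leRHS](@sqr_sqrtr R) ?ler0n // lerXn2r // nnegrE ?sqrtr_ge0 // ltW.
set Lam := 1 + _ in L1 *.
have L0 : 0 < Lam by exact: lt_le_trans L1.
elim: k kD => [_|k IH kD].
  (* The net {0} at scale 1, because T lies in the cube [-1, 1]^n. *)
  exists (fun=> 0), 1%N, (fun _ _ => 0); split.
  - by rewrite mul0r; exact: mean_le_cst.
  - move=> u ux; exists ord0; rewrite expr0 divr1.
    rewrite -[X in _ <= X%:R]card_ord -sumr_const; apply: ler_sum => i _.
    by rewrite subr0; case/andP: (norm_functional_le1 x1 ux i); nra.
  - by move=> _ a; rewrite big1 // => i _; rewrite mulr0.
  - by move=> _ w; rewrite big1 // => i _; rewrite mul0r.
have {}kD := kD isT.
have k40 m : 0 < 4 ^+ m :> R by rewrite exprn_gt0.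
have [_|W [N [F [WM Fnet Fx FW]]]] := IH.
  have k4 : 4 ^+ k <= 4 ^+ k.+1 :> R by rewrite exprS; have := k40 k; lra.
  by have := ler_wpM2l (sqr_ge0 M) k4; lra.
pose t : R := (2 ^+ k.+1)^-1.
have t0 : 0 < t by rewrite invr_gt0 exprn_gt0.
have t1 : t <= 1 by rewrite invf_le1 ?exprn_gt0 // exprn_ege1 // ler1n.
have tE : t ^+ 2 = (4 ^+ k.+1)^-1.
  by rewrite exprVn -exprM mulnC exprM; congr ((_ ^+ _)^-1); ring.
have [N' [F' [N'b F'x F'net]]] := exists_net_functionals n0 M0 Mn t0 t1
  (ltac:(by rewrite tE invrK) : 400 * M ^+ 2 / t ^+ 2 + 1 <= D) disc x1.
rewrite tE invrK -/Lam in N'b.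
have [pi piP] := choice (fun j => Fnet _ (F'x j)).
(* The optimal parameter of the Gaussian maximum: it balances B / s against
   s sigma2 / 2. *)
pose s := M * 4 ^+ k.+1 * Num.sqrt (n%:R * Lam) / n%:R.
have q0 : 0 < Num.sqrt (n%:R * Lam) by rewrite sqrtr_gt0 mulr_gt0.
have s0 : 0 < s by rewrite /s divr_gt0 // !mulr_gt0.
have [V VM FV] := mean_le_gaussian_max (v := fun j i => F' j i - F (pi j) i)
  gg s0 piP N'b.
exists (fun w => W w + V w), N', F'; split=> //.
- have -> : k.+1%:R * (2402 * M * Num.sqrt (n%:R * Lam)) =
    k%:R * (2402 * M * Num.sqrt (n%:R * Lam)) +
    (2400 * (M ^+ 2 * 4 ^+ k.+1) * Lam / s + s * (n%:R / 4 ^+ k) / 2).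
    have qq := sqr_sqrtr (ltW (mulr_gt0 nR L0)).
    rewrite /s -natr1 mulrDl mul1r; congr (_ + _); rewrite [4 ^+ k.+1]exprS.
    move: q0 qq; set q := Num.sqrt _ => q0 qq.
    have -> : Lam = q ^+ 2 / n%:R by rewrite qq mulrC mulKf // gt_eqF.
    by field; rewrite !gt_eqF.
  exact: mean_leD.
- by move=> u /F'net[j uj]; exists j; rewrite -tE.
- move=> j w; have := FW (pi j) w; have := FV j w.
  rewrite (eq_bigr (fun i => F' j i * g i w - F (pi j) i * g i w)) => [|i _].
    rewrite sumrB lerBlDr => h1 h2; apply: (le_trans h1).
    by rewrite addrC lerD2r.
  by rewrite mulrBl.
Qed.

Lemma min_signed_norm1 (R : realType) (E : normedModType R) (n : nat)
    (x : 'I_n -> E) (i : 'I_n) : `|x i| <= min_signed_norm x [set i].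
Proof.
apply/bigmin_geP; split=> [|eta _]; rewrite big_set1 //.
by rewrite normrZ normrX normrN1 expr1n mul1r.
Qed.

Lemma expectation_le_small_norms (R : realType) (E : normedModType R) (n : nat)
    (x : 'I_n -> E) (M : R) (d : measure_display) (T : measurableType d)
    (P : probability T R) (g : 'I_n -> {RV P >-> R}) :
  iid_standard_gaussian g -> 0 <= M -> (forall i, `|x i| <= M) ->
  ('E_P[(fun w => (`|\sum_(i < n) g i w *: x i|)%R)]
     <= (2 * expR (1 / 2) * M * n%:R)%:E)%E.
Proof.
move=> gg M0 xM.
pose W w := \sum_(i < n) M * (expR (g i w) + expR (- g i w)).
apply: (@expectation_le_mean _ _ _ _ _ W).
  move=> w; rewrite normr_ge0 /=; apply: (le_trans (ler_norm_sum _ _ _)).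
  apply: ler_sum => i _; rewrite normrZ mulrC.
  by apply: ler_pM => //; exact: norm_le_expR.
have -> : 2 * expR (1 / 2) * M * n%:R = \sum_(i < n) M * (2 * expR (1 / 2)).
  by rewrite sumr_const card_ord -[_ *+ n]mulr_natr; ring.
by apply: mean_le_sum => i; apply: mean_leZ => //; exact: mean_le_cosh.
Qed.

(** The error a . (u - v) of replacing u by a point v of the net is bounded
    coordinatewise by (t a_i^2 + y_i^2 / t) / 2, which weighs both squares
    evenly, a_i being of order 1 and y_i of order t. *)
Lemma norm_sum_le_net (R : realType) (E : normedModType R) (n N : nat)
    (x : 'I_n -> E) (F : 'I_N -> 'I_n -> R) (t : R) (a : 'I_n -> R) (W : R) :
  0 < t ->
  (forall u, norm_functional x u -> exists j, \sum_i (u i - F j i) ^+ 2 <= n%:R * t ^+ 2) ->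
  (forall j, \sum_i F j i * a i <= W) ->
  `|\sum_i a i *: x i| <=
    W + t / 2 * \sum_i (1 + 4 * (expR (a i) + expR (- a i))).
Proof.
move=> t0 Fnet FW.
have [u ux <-] := exists_norming_functional x a.
have [j uj] := Fnet u ux.
have -> : \sum_i a i * u i = \sum_i F j i * a i + \sum_i a i * (u i - F j i).
  by rewrite -big_split; apply: eq_bigr => i _ /=; ring.
apply: lerD; first exact: FW.
apply: (@le_trans _ _ (\sum_i (t / 2 * a i ^+ 2 + t^-1 / 2 * (u i - F j i) ^+ 2))).
  apply: ler_sum => i _; set y := u i - F j i.
  have : 0 <= t^-1 / 2 * (t * a i - y) ^+ 2.
    by rewrite mulr_ge0 ?sqr_ge0 // divr_ge0 // invr_ge0 ltW.
  have -> : t^-1 / 2 * (t * a i - y) ^+ 2 =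
      t / 2 * a i ^+ 2 + t^-1 / 2 * y ^+ 2 - a i * y by field; exact: lt0r_neq0.
  by rewrite subr_ge0.
rewrite big_split /= -!mulr_sumr.
have h1 : t^-1 / 2 * \sum_i (u i - F j i) ^+ 2 <= t / 2 * n%:R.
  have -> : t / 2 * n%:R = t^-1 / 2 * (n%:R * t ^+ 2) by field; exact: lt0r_neq0.
  by rewrite ler_pM2l // divr_gt0 // invr_gt0.
have h2 : \sum_i a i ^+ 2 <= \sum_i 4 * (expR (a i) + expR (- a i)).
  by apply: ler_sum => i _; exact: sqr_le_expR.
rewrite big_split /= sumr_const card_ord mulrDr.
have := ler_wpM2l (ltW (divr_gt0 t0 (ltr0n R 2))) h2.
by lra.
Qed.

(** The last scale of the chaining: the first k for which the upper inequality
    holds. *)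
Lemma exists_scale (R : realType) (c y : R) : 0 < c ->
  exists k : nat, ((0 < k)%N -> c * 4 ^+ k <= y) /\ y < 4 * c * 4 ^+ k.
Proof.
move=> c0.
have ex : exists k : nat, y < 4 * c * 4 ^+ k.
  exists (Num.bound (y / c)).
  set k := Num.bound _.
  have : y / c < k%:R.
    have [yc|yc] := lerP 0 (y / c); first exact: archi_boundP.
    exact: lt_le_trans yc (ler0n _ _).
  rewrite ltr_pdivrMr // => /lt_le_trans; apply.
  have k4 : k%:R <= 4 ^+ k :> R by rewrite -natrX ler_nat ltnW // ltn_expl.
  have c4 : 0 <= c * 4 ^+ k by rewrite mulr_ge0 ?exprn_ge0 // ltW.
  by have := ler_wpM2l (ltW c0) k4; lra.
case: (ex_minnP ex) => k yk kmin; exists k; split=> // k0.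
rewrite leNgt; apply/negP => ky.
have kE : 4 ^+ k = 4 * 4 ^+ k.-1 :> R by rewrite -exprS prednK.
have : (k <= k.-1)%N by apply: kmin; rewrite [4 * c]mulrC -mulrA -kE.
by rewrite -ltnS prednK // ltnn.
Qed.

(** Where the logarithmic hypothesis on lambda is spent; (1 + l)^3 <= 4 (1 + l^3)
    reduces the claim to lambda <= 1 and lambda l^3 < 1. *)
Lemma log_factor_bound (R : realType) (s lambda : R) :
  1 <= s -> 0 < lambda -> lambda <= 1 -> (lambda%:E < log_inv3 s)%E ->
  lambda * (1 + ln s) ^+ 3 <= 8.
Proof.
move=> s1 l0 l1; rewrite /log_inv3; have := ln_ge0 s1; move: (ln s) => l.
rewrite le_eqVlt => /predU1P[<- _|lpos]; first by rewrite addr0 expr1n; lra.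
have l3 : 0 < l ^+ 3 by rewrite exprn_gt0.
rewrite inver gt_eqF // lte_fin => ll.
have : lambda * l ^+ 3 < 1 by rewrite -ltr_pdivlMr // div1r.
have : (1 + l) ^+ 3 <= 4 * (1 + l ^+ 3).
  rewrite -subr_ge0.
  have -> : 4 * (1 + l ^+ 3) - (1 + l) ^+ 3 = 3 * ((1 + l) * (1 - l) ^+ 2) by ring.
  by apply: mulr_ge0 => //; apply: mulr_ge0; [lra | exact: sqr_ge0].
by move=> h1 h2; have := ler_wpM2l (ltW l0) h1; lra.
Qed.

Lemma expR_nat_le (R : realType) (k : nat) : expR k%:R <= 4 ^+ k :> R.
Proof.
have h : expR (1 / 2) <= 2 :> R.
  have := expR_ge1Dx (- (1 / 2) : R); rewrite expRN => h.
  have e0 := expR_gt0 (1 / 2 : R).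
  have : (1 - 1 / 2) * expR (1 / 2) <= 1 :> R.
    by rewrite -ler_pdivlMr // [leRHS]div1r.
  by lra.
have -> : expR k%:R = (expR (1 / 2) ^+ 2) ^+ k :> R.
  by rewrite -exprM -expRM_natl natrM; congr expR; field.
rewrite lerXn2r ?nnegrE ?exprn_ge0 ?expR_ge0 //.
have -> : 4 = 2 ^+ 2 :> R by ring.
by rewrite lerXn2r ?nnegrE ?expR_ge0.
Qed.

(* The hypotheses lambda <= 1 and (lambda * n < 1 -> ...) only exclude degenerate
   ranges in which the claim fails. If lambda * n < 1 the condition on sigma
   concerns the empty set alone; there it is also required of singletons. *)
Theorem lemma3p1 (R : realType) :
  exists C : R,
    forall (E : completeNormedModType R) (n : nat) (x : 'I_n -> E)
      (M lambda : R) (d : measure_display) (T : measurableType d)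
      (P : probability T R) (g : 'I_n -> {RV P >-> R}),
    iid_standard_gaussian g ->
    (forall i, `|x i| <= 1) ->
    0 < M -> M <= Num.sqrt n%:R ->
    0 < lambda -> (lambda%:E < log_inv3 (n%:R / M ^+ 2))%E ->
    lambda <= 1 ->
    (lambda * n%:R < 1 -> forall i, min_signed_norm x [set i] <= M) ->
    (forall sigma : {set 'I_n}, #|sigma|%:R <= lambda * n%:R ->
       min_signed_norm x sigma <= M * Num.sqrt #|sigma|%:R) ->
    ('E_P[(fun w => (`|\sum_(i < n) g i w *: x i|)%R)]
       <= (C * M * Num.sqrt (n%:R / lambda))%:E)%E.
Proof.
exists (7206 + 29 * (1 + 8 * expR (1 / 2))).
move=> E n x M lambda d T P g gg x1 M0 Mn l0 lam l1 single disc.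
have n0 : (0 < n)%N.
  by rewrite lt0n; apply/eqP => n0; move: Mn; rewrite n0 sqrtr0 leNgt M0.
have nR : 0 < n%:R :> R by rewrite ltr0n.
have M2n : M ^+ 2 <= n%:R.
  by rewrite -[leRHS](@sqr_sqrtr R) ?ler0n // lerXn2r // nnegrE ?sqrtr_ge0 // ltW.
have M20 : 0 < M ^+ 2 by rewrite exprn_gt0.
have r1 : 1 <= n%:R / M ^+ 2 by rewrite ler_pdivlMr // mul1r.
pose kappa : R := expR (1 / 2); rewrite -/kappa.
have kap0 : 0 < kappa by exact: expR_gt0.
pose Q := Num.sqrt (n%:R / lambda); rewrite -/Q.
have Q2 : Q ^+ 2 = n%:R / lambda by rewrite sqr_sqrtr // divr_ge0 // ltW.
have Q0 : 0 < Q by rewrite sqrtr_gt0 divr_gt0.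
have le_of_sqr (y c : R) : 0 <= c -> y ^+ 2 <= c ^+ 2 * Q ^+ 2 -> y <= c * Q.
  move=> c0; rewrite -exprMn => h; rewrite leNgt; apply/negP => cy.
  have cQ : 0 <= c * Q by rewrite mulr_ge0 // ltW.
  have : (c * Q) ^+ 2 < y ^+ 2.
    by rewrite ltrXn2r ?nnegrE ?cy //; exact: le_trans cQ (ltW cy).
  by rewrite ltNge h.
have [ln2|ln2] := ltP (lambda * n%:R) 2.
  have xM i : `|x i| <= M.
    apply: (le_trans (min_signed_norm1 x i)).
    have [/single//|ln1] := ltP (lambda * n%:R) 1.
    by have := disc [set i]; rewrite cards1 sqrtr1 mulr1; apply.
  apply: (le_trans (expectation_le_small_norms gg (ltW M0) xM)); rewrite lee_fin.
  have nQ : n%:R <= 2 * Q.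
    apply: le_of_sqr => //; rewrite Q2 expr2 mulrA ler_pdivlMr //.
    by rewrite -mulrA [n%:R * lambda]mulrC; have := ler_wpM2l (ltW nR) (ltW ln2); lra.
  have kM : 0 <= kappa * M by rewrite mulr_ge0 // ltW.
  have := ler_wpM2l kM nQ.
  have : 0 <= M * Q by rewrite mulr_ge0 // ltW.
  have : 0 <= kappa * M * Q by rewrite mulr_ge0 // ltW.
  by rewrite -/kappa; lra.
(* The factor 800 leaves room for the additive 1 in the range of the sign
   hypothesis, as lambda n >= 2. *)
have [k [klow kup]] := exists_scale (lambda * n%:R) (mulr_gt0 (ltr0n R 800) M20).
have kD : (0 < k)%N -> 400 * M ^+ 2 * 4 ^+ k + 1 <= lambda * n%:R.
  by move/klow; lra.
have [W [N [F [WM Fnet Fx FW]]]] := mean_le_chaining gg n0 M0 Mn kD disc x1.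
pose t : R := (2 ^+ k)^-1.
have t0 : 0 < t by rewrite invr_gt0 exprn_gt0.
have tE : t ^+ 2 = (4 ^+ k)^-1.
  by rewrite exprVn -exprM mulnC exprM; congr ((_ ^+ _)^-1); ring.
rewrite -tE in Fnet.
have bound w := norm_sum_le_net t0 Fnet (fun j => FW j w).
apply: (expectation_le_mean (fun w => _)) => [w|].
  by apply/andP; split; [exact: normr_ge0 | exact: bound].
set Lam := 1 + ln _ in WM.
apply: (@mean_leW _ _ _ _ _ (k%:R * (2402 * M * Num.sqrt (n%:R * Lam)) +
    t / 2 * \sum_(i < n) (1 + 4 * (2 * kappa)))); last first.
  apply: mean_leD => //; apply: mean_leZ; first by rewrite divr_ge0 // ltW.
  apply: mean_le_sum => i; apply: mean_leD; first exact: mean_le_cst.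
  by apply: mean_leZ => //; exact: mean_le_cosh.
have kLam : k%:R <= Lam.
  have : k%:R <= ln (n%:R / M ^+ 2).
    have [->|/klow kl] := posnP k; first exact: ln_ge0.
    rewrite -[leLHS](@expRK R) ler_ln ?posrE ?expR_gt0 //; last exact: lt_le_trans r1.
    apply: (le_trans (expR_nat_le _ _)); rewrite ler_pdivlMr //.
    have p0 : 0 <= M ^+ 2 * 4 ^+ k by rewrite mulr_ge0 ?exprn_ge0 // ltW.
    by have := ler_wpM2r (ltW nR) l1; lra.
  by move/le_trans; apply; rewrite lerDr.
have Lam3 : lambda * Lam ^+ 3 <= 8 by exact: log_factor_bound lam.
have Lam0 : 0 < Lam by rewrite ltr_pwDl // ln_ge0.
have first : k%:R * Num.sqrt (n%:R * Lam) <= 3 * Q.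
  apply: le_of_sqr => //; rewrite exprMn sqr_sqrtr ?mulr_ge0 // ?(ltW Lam0) // Q2.
  apply: (@le_trans _ _ (Lam ^+ 2 * (n%:R * Lam))).
    rewrite ler_pM2r ?mulr_gt0 // lerXn2r ?nnegrE //; exact: ltW.
  rewrite [leRHS]mulrA ler_pdivlMr //.
  have -> : Lam ^+ 2 * (n%:R * Lam) * lambda = n%:R * (lambda * Lam ^+ 3) by ring.
  by have := ler_wpM2l (ltW nR) Lam3; lra.
have second : t * n%:R <= 57 * M * Q.
  apply: le_of_sqr; first by rewrite mulr_ge0 // ltW.
  rewrite exprMn tE Q2 mulrC ler_pdivrMr ?exprn_gt0 //.
  have -> : (57 * M) ^+ 2 * (n%:R / lambda) * 4 ^+ k =
     (57 ^+ 2 * M ^+ 2 * 4 ^+ k * n%:R) / lambda by ring.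
  rewrite ler_pdivlMr //.
  have -> : n%:R ^+ 2 * lambda = lambda * n%:R * n%:R by ring.
  rewrite ler_pM2r //.
  have p0 : 0 <= M ^+ 2 * 4 ^+ k by rewrite mulr_ge0 ?exprn_ge0 // ltW.
  by lra.
rewrite sumr_const card_ord -[X in t / 2 * X]mulr_natr.
have h1 := ler_wpM2l (ltW M0) first.
have h2 : (1 + 8 * kappa) * (t * n%:R) <= (1 + 8 * kappa) * (57 * M * Q).
  by rewrite ler_pM2l //; lra.
have MQ : 0 <= M * Q by rewrite mulr_ge0 // ltW.
have kMQ : 0 <= kappa * (M * Q) by rewrite mulr_ge0 // ltW.
have -> : k%:R * (2402 * M * Num.sqrt (n%:R * Lam)) =
    2402 * (M * (k%:R * Num.sqrt (n%:R * Lam))) by ring.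
have -> : t / 2 * ((1 + 4 * (2 * kappa)) * n%:R) =
    (1 + 8 * kappa) * (t * n%:R) / 2 by field.
by lra.
Qed.
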